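(* Let $U:\mathcal H\to\mathcal H$ be a unitary operator on a Hilbert space and let $v(x)=\sum_{j=1}^\ell a_jx^{2j-1}$ be a non-zero odd polynomial with $v(\mathbb{Z})\subseteq\mathbb{Z}$. The following are equivalent: (i) $U$ has discrete spectrum (i.e. $\mathcal H$ is the closed linear span of eigenvectors of $U$). (ii) For every $f\in\mathcal H$ and every $\epsilon>0$, the set $\{n\in\mathbb{N}:\|U^{v(n)}f-f\|_{\mathcal H}<\epsilon\}$ is $\Delta_{\ell,0}^*$. (iii) For every $f\in\mathcal H$ and every $\epsilon>0$, the set $\{n\in\mathbb{N}:\|U^{v(n)}f-f\|_{\mathcal H}<\epsilon\}$ is $\Delta_\ell^*$.
   Context: $\mathbb{N}=\{1,2,\dots\}$. Define $\partial:\bigcup_{\ell\ge1}\mathbb{Z}^{2^\ell}\to\mathbb{Z}$ recursively by $\partial(m_1,m_2)=m_2-m_1$ and $\partial(m_1,\dots,m_{2^\ell})=\partial(m_{2^{\ell-1}+1},\dots,m_{2^\ell})-\partial(m_1,\dots,m_{2^{\ell-1}})$ for $\ell>1$. For a finite or infinite sequence $(n_k)$ in $\mathbb{Z}$, $D_\ell((n_k))=\{\partial(n_{j_1},\dots,n_{j_{2^\ell}}): j_1<\dots<j_{2^\ell}\}$. For $r\ge2^\ell$, $E\subseteq\mathbb{N}$ is a $\Delta_{\ell,r}$ set if $D_\ell((n_k)_{k=1}^r)\subseteq E$ for some $r$-element sequence $(n_k)_{k=1}^r$ in $\mathbb{Z}$; $E$ is a $\Delta_{\ell,0}$ set if it contains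 a $\Delta_{\ell,r}$ set for every $r\ge2^\ell$; $E$ is $\Delta_{\ell,0}^*$ if it meets every $\Delta_{\ell,0}$ set. $E$ is $\Delta_\ell^*$ if for every increasing sequence $(n_k)_{k\in\mathbb{N}}$ in $\mathbb{N}$, $E\cap D_\ell((n_k)_{k\in\mathbb{N}})\neq\emptyset$. *)

(* Defs.v *)
From HB Require Import structures.
From mathcomp Require Import all_boot all_order all_algebra.
From mathcomp Require Import sesquilinear complex.
From mathcomp Require Import all_classical all_reals topology normedtype.

Set Implicit Arguments.
Unset Strict Implicit.
Unset Printing Implicit Defensive.

Import Order.TTheory GRing.Theory Num.Theory.
Import numFieldNormedType.Exports.

Local Open Scope classical_set_scope.
Local Open Scope ring_scope.
Local Open Scope complex_scope.

(* On a list of length 2 ^ l.  The recursion starts at l = 0 with the identity,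
   so that iter_diff 1 [:: m1; m2] = m2 - m1; see iter_diff1. *)
Fixpoint iter_diff (l : nat) (m : seq int) : int :=
  if l is l'.+1 then
    iter_diff l' (drop (2 ^ l') m) - iter_diff l' (take (2 ^ l') m)
  else head 0 m.

Lemma iter_diff1 (m1 m2 : int) : iter_diff 1 [:: m1; m2] = m2 - m1.
Proof. by []. Qed.

(* The index type I is 'I_r for finite sequences and nat for infinite ones. *)
Definition diff_set (l : nat) (disp : Order.disp_t) (I : porderType disp)
    (n : I -> int) : set int :=
  [set d | exists j : (2 ^ l).-tuple I,
     sorted <%O j /\ d = iter_diff l [seq n i | i <- j]].

Definition posnat : set nat := [set n | (0 < n)%N].

Definition is_Delta (l r : nat) (E : set nat) : Prop :=
  [/\ E `<=` posnat, (2 ^ l <= r)%N &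
      exists n : 'I_r -> int, diff_set l n `<=` [set Posz k | k in E]].

Definition is_Delta0 (l : nat) (E : set nat) : Prop :=
  E `<=` posnat /\
  forall r, (2 ^ l <= r)%N -> exists F, is_Delta l r F /\ F `<=` E.

Definition is_Delta0_star (l : nat) (E : set nat) : Prop :=
  E `<=` posnat /\ forall F, is_Delta0 l F -> E `&` F !=set0.

Definition is_Delta_star (l : nat) (E : set nat) : Prop :=
  E `<=` posnat /\
  forall n : nat -> nat, (forall k, posnat (n k)) ->
    (forall i j, (i < j)%N -> (n i < n j)%N) ->
    [set Posz k | k in E] `&` diff_set l (fun k => Posz (n k)) !=set0.

Section Operators.
Variables (R : realType) (H : completeNormedModType R[i]).

Definition is_inner_product (dot : {dot H for Num.conj}) : Prop :=
  forall x : H, `|x| ^+ 2 = dot x x.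

Record unitary (dot : {dot H for Num.conj}) := Unitary {
  uop :> {linear H -> H};
  uadj : H -> H;
  uadjP : forall x y, dot (uop x) y = dot x (uadj y);
  uopK : cancel uop uadj;
  uadjK : cancel uadj uop
}.

Definition upow (dot : {dot H for Num.conj}) (U : unitary dot) (z : int) :
    H -> H :=
  match z with
  | Posz n => iter n U
  | Negz n => iter n.+1 (uadj U)
  end.

Definition eigenvectors (T : H -> H) : set H :=
  [set x | x != 0 /\ exists lambda : R[i], T x = lambda *: x].

Definition lin_span (A : set H) : set H :=
  [set x | exists (n : nat) (c : 'I_n -> R[i]) (e : 'I_n -> H),
     (forall i, A (e i)) /\ x = \sum_(i < n) c i *: e i].

Definition discrete_spectrum (T : H -> H) : Prop :=
  closure (lin_span (eigenvectors T)) = setT.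

(* The integer value v(n) is recovered as the floor of the real v.[n], to be
   used only for polynomials taking integer values on the integers. *)
Definition return_times (dot : {dot H for Num.conj}) (U : unitary dot)
    (v : {poly R}) (f : H) (eps : R) : set nat :=
  [set n | posnat n /\ `|upow U (Num.floor v.[n%:R]) f - f| < eps%:C].

End Operators.

(* Index j : 'I_l stands for j + 1 in 1, ..., l, whence exponent 2 j + 1. *)
Definition oddpoly (R : realType) (l : nat) (a : 'I_l -> R) : {poly R} :=
  \sum_(j < l) a j *: 'X^(j.*2.+1).

(* Main.v *)
(* (i) => (ii).  On finite sums of eigenvectors ||U^z f - f|| is bounded by p(z),
   where p is an even, subadditive, totally bounded function on the real line.
   By Ramsey's theorem one may pass to a subsequence along which every monomial
   b n_(i_1)^(e_1) ... n_(i_k)^(e_k), i_1 < ... < i_k, of the expansion of v is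
   p-close to a constant depending only on e.  Hence v of an iterated difference
   is p-close to a combination of these constants whose coefficients are the
   monomial quasi-symmetric functions evaluated at the Thue-Morse signs of the
   iterated difference, and those vanish in odd degrees below 2 l.

   (ii) => (iii).  Along a subsequence with n_(k+1) >= 2 n_k all iterated
   differences are positive.

   (iii) => (i).  A set of upper density zero is avoided by the iterated
   differences of a greedily chosen sequence, so the return times have positive
   upper density; taking differences of n and n + h for suitable h lowers the
   degree of v until it is linear, and disjointness of translates then shows that
   all orbits are totally bounded.  If the eigenvectors did not span, some g != 0
   would be orthogonal to all of them.  For an almost period q of g, Parseval's
   identity on Z/q produces a root of unity v for which the average of the
   v^n U^n g over n < q has norm bounded below.  As q grows, these averages, which
   stay in a totally bounded set, cluster at an eigenvector not orthogonal to g. *)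

Require Import Defs.
From mathcomp Require Import all_boot all_order all_algebra cyclic separable cyclotomic.
From mathcomp Require Import sesquilinear complex.
From mathcomp Require Import all_classical all_reals topology normedtype.
From mathcomp Require Import trigo.
From mathcomp Require Import zify ring lra.

Set Implicit Arguments.
Unset Strict Implicit.
Unset Printing Implicit Defensive.

Import Order.TTheory GRing.Theory Num.Theory.
Import numFieldNormedType.Exports.

Local Open Scope ring_scope.

(** * Ramsey's theorem for sublists of finite lists *)

Lemma subseq_cons2 (T : eqType) (x y : T) (u s : seq T) :
  subseq (y :: u) (x :: s) -> (y = x /\ subseq u s) \/ subseq (y :: u) s.
Proof. by rewrite /=; case: eqP => [-> ?|_ ?]; [left|right]. Qed.

(** A [k]-subset is encoded as a sublist of length [k], because the monomials coloured later depend
    on the order of their indices. *)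
Definition homogeneous (T : eqType) (C : Type) (k : nat) (col : seq T -> C)
    (t : seq T) : Prop :=
  exists c, forall u, subseq u t -> size u = k -> col u = c.

Lemma homogeneous_subseq (T : eqType) (C : Type) k (col : seq T -> C) s t :
  subseq s t -> homogeneous k col t -> homogeneous k col s.
Proof.
by move=> st [c hc]; exists c => u us; apply: hc; apply: subseq_trans st.
Qed.

Lemma count_color (T : eqType) (C : finType) (c : T -> C) (m : nat) (s : seq T) :
  (#|C| * m < size s)%N -> exists c0, (m <= count (fun x => c x == c0) s)%N.
Proof.
move=> ms; apply/existsP; apply: contraTT ms => /existsPn h; rewrite -leqNgt.
have -> : size s = (\sum_(i : C) count (fun x => c x == i) s)%N.
  elim: s {h} => [|x s IHs] /=; first by rewrite big1.
  rewrite big_split /= -IHs (bigD1 (c x)) //= eqxx big1 ?addn0 // => i.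
  by rewrite eq_sym => /negPf ->.
rewrite -sum_nat_const; apply: leq_sum => i _.
by apply: ltnW; rewrite ltnNge; apply: h.
Qed.

(** [N] is fixed before [T], since it will be applied to ['I_r] for every large [r]. *)
Lemma ramsey (C : finType) (k m : nat) :
  exists N, forall (T : eqType) (col : seq T -> C) (s : seq T),
    uniq s -> (N <= size s)%N ->
    exists t, [/\ subseq t s, (m <= size t)%N & homogeneous k col t].
Proof.
elim: k m => [|k IHk] m.
  exists m => T col s _ ms; exists s; split=> //; exists (col [::]) => u _.
  by move/size0nil ->.
(* A long list on which the colour of a set depends only on its first element *)
have [N hN] : exists N, forall (T : eqType) (col : seq T -> C) (s : seq T),
    uniq s -> (N <= size s)%N ->
    exists t, [/\ subseq t s, (#|C| * m < size t)%N & exists c : T -> C,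
      forall x u, subseq (x :: u) t -> size u = k -> col (x :: u) = c x].
  elim: (#|C| * m).+1 => [|n [N IHn]].
    exists 1%N => T col [//|x s] us _; exists [::]; split=> //.
    by exists (fun _ => col [:: x]) => y u; rewrite subseq0.
  have [N' hN'] := IHk N; exists N'.+1 => T col [//|x s] /= /andP[xs us] Ns.
  have [t [ts Nt [c0 hc0]]] := hN' T (fun u => col (x :: u)) s us Ns.
  have [t' [t't nt' [c hc]]] := IHn T col t (subseq_uniq ts us) Nt.
  exists (x :: t'); split=> //.
    by rewrite eqxx; apply: subseq_trans ts.
  exists (fun y => if y == x then c0 else c y) => y u /subseq_cons2[[-> ut']|yu] su.
    by rewrite eqxx; apply: hc0 => //; apply: subseq_trans t't.
  case: eqP => [yx|_]; last exact: hc.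
  case/negP: xs; rewrite -yx; apply: (mem_subseq ts); apply: (mem_subseq t't).
  by apply: (mem_subseq yu); rewrite mem_head.
exists N => T col s us Ns; have [t [ts mt [c hc]]] := hN T col s us Ns.
have [c0 hc0] := count_color c mt.
exists [seq x <- t | c x == c0]; split.
- by apply: subseq_trans ts; apply: filter_subseq.
- by rewrite size_filter.
exists c0 => -[//|x u] xu [su].
rewrite (hc x u) //; last by apply: subseq_trans xu _; apply: filter_subseq.
have : x \in [seq x <- t | c x == c0] by apply: (mem_subseq xu); rewrite mem_head.
by rewrite mem_filter => /andP[/eqP].
Qed.

(** The list is thinned out once for each colouring; homogeneity already achieved passes to
    sublists. *)
Lemma ramsey_seq (C : finType) (I : eqType) (k : I -> nat) (L : seq I) (m : nat) :
  exists N, forall (T : eqType) (col : I -> seq T -> C) (s : seq T),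
    uniq s -> (N <= size s)%N ->
    exists t, [/\ subseq t s, (m <= size t)%N &
      forall i, i \in L -> homogeneous (k i) (col i) t].
Proof.
elim: L => [|i L [N IHL]] /=.
  by exists m => T col s us ms; exists s.
have [N' hN'] := ramsey C (k i) N; exists N' => T col s us Ns.
have [t [ts Nt ht]] := hN' T (col i) s us Ns.
have [t' [t't mt' ht']] := IHL T col t (subseq_uniq ts us) Nt.
exists t'; split=> //; first exact: subseq_trans ts.
move=> j; rewrite inE => /predU1P[->|]; last exact: ht'.
exact: homogeneous_subseq ht.
Qed.

(** * Quasi-symmetric sums *)

(* The monomial quasi-symmetric function: the sum over i_1 < ... < i_k of
   y_(i_1) ^ e_1 ... y_(i_k) ^ e_k, where k is the size of e. *)
Fixpoint qsym (A : nzRingType) (y : seq A) (e : seq nat) : A :=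
  if y is x :: y' then
    qsym y' e + (if e is d :: e' then x ^+ d * qsym y' e' else 0)
  else (nilp e)%:R.

Fixpoint monom (A : nzRingType) (x : seq A) (e : seq nat) : A :=
  if x is a :: x' then
    if e is d :: e' then a ^+ d * monom x' e' else 1
  else 1.

(** The quasi-shuffle of [e] with the one-part composition 1: either a part is raised by 1 or a new
    part 1 is inserted. *)
Fixpoint insert1 (e : seq nat) : seq (seq nat) :=
  if e is d :: e' then
    (d.+1 :: e') :: (1%N :: d :: e') :: [seq d :: f | f <- insert1 e']
  else [:: [:: 1%N]].

(* Compositions of d, listed with multiplicity. *)
Fixpoint comps (d : nat) : seq (seq nat) :=
  if d is d'.+1 then flatten [seq insert1 e | e <- comps d'] else [:: [::]].

Lemma insert1P (e f : seq nat) : f \in insert1 e -> all (leq 1) e ->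
  sumn f = (sumn e).+1 /\ all (leq 1) f.
Proof.
elim: e f => [|d e IHe] f /=; first by rewrite inE => /eqP ->.
rewrite !inE => /or3P[/eqP -> /=|/eqP -> /=|/mapP[g ge ->]].
- by case/andP.
- by move=> ->.
by case/andP=> d1 e1 /=; have [-> ->] := IHe g ge e1; rewrite d1 addnS.
Qed.

Lemma compsP d f : f \in comps d -> sumn f = d /\ all (leq 1) f.
Proof.
elim: d f => [|d IHd] f /=; first by rewrite inE => /eqP ->.
case/flattenP => s /mapP[e ed ->] fe; have [se ae] := IHd e ed.
by have [-> ->] := insert1P fe ae; rewrite se.
Qed.

Section QSym.
Variable A : comNzRingType.
Implicit Types (x : A) (y z : seq A) (e f : seq nat).

Lemma qsym_nil y : qsym y [::] = 1.
Proof. by elim: y => //= x y ->; rewrite addr0. Qed.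

(** A further index either coincides with one of [i_1 < ... < i_k], which raises its exponent, or
    falls into a gap, which inserts an exponent 1. *)
Lemma sum_mul_qsym y e :
  (\sum_(x <- y) x) * qsym y e = \sum_(f <- insert1 e) qsym y f.
Proof.
elim: y e => [|x y IHy] e.
  rewrite big_nil mul0r big1_seq // => f /andP[_ fe].
  case: e fe => [|d e] /=; first by rewrite inE => /eqP ->.
  by rewrite !inE => /or3P[/eqP->|/eqP->|/mapP[g _ ->]].
rewrite big_cons; case: e => [|d e].
  have := IHy [::]; rewrite qsym_nil mulr1 big_seq1 /= big_seq1 /= => ->.
  by rewrite addr0 !qsym_nil !mulr1 expr1 addrC.
rewrite /= !big_cons /= big_map big_split /=.
have := IHy (d :: e); rewrite /= !big_cons big_map => h.
rewrite -mulr_sumr -IHy [LHS]mulrDr mulrDl h exprS expr1.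
ring.
Qed.

Lemma sum_exp_qsym y d : (\sum_(x <- y) x) ^+ d = \sum_(f <- comps d) qsym y f.
Proof.
elim: d => [|d IHd]; first by rewrite expr0 big_seq1 qsym_nil.
rewrite exprS IHd mulr_sumr /= big_flatten big_map.
by apply: eq_bigr => f _; rewrite sum_mul_qsym.
Qed.

(** The chosen indices split into an initial group lying in [y] and a final group lying in [z]. *)
Lemma qsym_cat y z e :
  qsym (y ++ z) e =
  \sum_(0 <= i < (size e).+1) qsym y (take i e) * qsym z (drop i e).
Proof.
elim: y e => [|x y IHy] e /=.
  rewrite big_nat_recl // take0 drop0 mul1r big_nat big1 ?addr0 // => i /andP[_ ie].
  by case: e ie => [//|d e] _; rewrite /= mul0r.
case: e => [|d e].
  by rewrite IHy /= !big_nat1 /= !addr0.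
rewrite !IHy [X in X + _]big_nat_recl // [RHS]big_nat_recl //=.
rewrite !qsym_nil addr0 mul1r -addrA; congr (_ + _).
rewrite mulr_sumr -big_split /=; apply: eq_big_nat => i _.
by rewrite mulrDl mulrA.
Qed.

Lemma qsymN y e : qsym [seq - x | x <- y] e = (-1) ^+ sumn e * qsym y e.
Proof.
elim: y e => [|x y IHy] [|d e] //=; rewrite ?mulr1 ?mulr0 //.
  by rewrite !addr0 !qsym_nil mul1r.
rewrite !IHy /= exprD mulrDr; congr (_ + _).
by rewrite (exprNn x); ring.
Qed.

End QSym.

(** The Thue-Morse signs with which the entries of a list enter [iter_diff l], normalised so that
    the last sign is +1. *)
Fixpoint morse (A : nzRingType) (l : nat) : seq A :=
  if l is l'.+1 then [seq - x | x <- morse A l'] ++ morse A l' else [:: 1].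

Lemma size_morse (A : nzRingType) l : size (morse A l) = (2 ^ l)%N.
Proof. by elim: l => //= l IHl; rewrite size_cat size_map IHl expnS mul2n addnn. Qed.

Lemma morse_sign (A : nzRingType) l x : x \in morse A l -> x = 1 \/ x = -1.
Proof.
elim: l x => [|l IHl] x /=; first by rewrite inE => /eqP; left.
rewrite mem_cat => /orP[/mapP[y /IHl[] -> ->]|/IHl //]; [by right|left].
by rewrite opprK.
Qed.

Lemma iter_diff_morse l (m : seq int) : size m = (2 ^ l)%N ->
  iter_diff l m = \sum_(z <- zip (morse int l) m) z.1 * z.2.
Proof.
elim: l m => [|l IHl] m; first by case: m => [|x []] //= _; rewrite big_seq1 mul1r.
rewrite expnS mul2n -addnn /= => sm.
have st : size (take (2 ^ l) m) = (2 ^ l)%N by rewrite size_takel // sm leq_addr.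
have sd : size (drop (2 ^ l) m) = (2 ^ l)%N by rewrite size_drop sm addnK.
rewrite -[in RHS](cat_take_drop (2 ^ l) m) zip_cat ?size_map ?size_morse //.
rewrite big_cat /= IHl // IHl // addrC; congr (_ + _).
elim: (morse int l) (take _ m) => [|x s IHs] [|y t] /=; rewrite ?big_nil ?oppr0 //.
by rewrite !big_cons -IHs /= mulNr opprD.
Qed.

(* If the odd part of a noncommutative generating series W = P + Q has lowest
   weight 2 l + 1, then that of (P - Q) (P + Q) is [P - 1, Q], of weight at
   least 2 l + 3. *)
Lemma qsym_morse (A : comNzRingType) l e :
  odd (sumn e) -> (sumn e < l.*2)%N -> all (leq 1) e -> qsym (morse A l) e = 0.
Proof.
elim: l e => [|l IHl] e // oe se ae.
rewrite /= qsym_cat; under eq_big_nat do rewrite qsymN.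
case: e oe se ae => [//|d e] oe se ae.
(* The two extreme splittings of [e] cancel, since the total weight is odd. *)
rewrite big_nat_recl // big_nat_recr //= take_size drop_size !qsym_nil.
rewrite big_nat big1 => [|i /andP[_ ie]].
  by rewrite expr0 -(signr_odd _ (d + _)) (oe : odd (d + sumn e)) expr1; ring.
have sE : sumn (d :: e) = (d + sumn (take i e) + sumn (drop i e))%N.
  by rewrite /= -[in LHS](cat_take_drop i e) sumn_cat addnA.
have /andP[at_ ad] : all (leq 1) (d :: take i e) && all (leq 1) (drop i e).
  by rewrite -all_cat cat_cons cat_take_drop.
have d1 : (0 < d)%N by case/andP: ae.
have sd : (0 < sumn (drop i e))%N.
  have {ie}ie : (i < size e)%N := ie.
  case: (drop i e) (size_drop i e) ad => [/= h|x s _ /=].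
    by move: ie; rewrite -subn_gt0 -h.
  by case/andP => x1 _; lia.
(* Both parts have positive weight and the total is odd and at most 2 l + 1, so the part of odd
   weight has weight below 2 l and vanishes by induction. *)
have [od|ed] := boolP (odd (sumn (drop i e))).
  by rewrite [X in _ * X]IHl ?mulr0 //; move: oe; rewrite sE !oddD; lia.
rewrite [X in _ * X * _]IHl ?mulr0 ?mul0r //=; move: oe se; rewrite sE ?oddD; lia.
Qed.

(** * Recurrence of odd polynomials along iterated differences *)

Section Recurrence.
Variable R : realType.

(** Total boundedness is phrased by finite colourings with small classes, the form to which Ramsey's
    theorem applies. There is no homogeneity: only signs can be taken out of [p]. *)
Record seminorm (p : R -> R) : Prop := Seminorm {
  seminorm0 : p 0 = 0;
  seminormN : forall x, p (- x) = p x;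
  seminormD : forall x y, p (x + y) <= p x + p y;
  seminorm_tb : forall eps : R, 0 < eps -> exists (C : finType) (c : R -> C),
    forall x y, c x = c y -> p (x - y) <= eps
}.

Variables (p : R -> R) (hp : seminorm p).

Lemma seminorm_sum (I : Type) (r : seq I) (F : I -> R) :
  p (\sum_(i <- r) F i) <= \sum_(i <- r) p (F i).
Proof.
elim: r => [|i r IHr]; first by rewrite !big_nil (seminorm0 hp).
by rewrite !big_cons; apply: le_trans (seminormD hp _ _) _; rewrite lerD2l.
Qed.

Lemma seminorm_sign (s x : R) d : s = 1 \/ s = -1 -> p (s ^+ d * x) = p x.
Proof.
case=> ->; first by rewrite expr1n mul1r.
by rewrite -signr_odd; case: odd; rewrite ?expr0 ?expr1 ?mul1r // mulN1r (seminormN hp).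
Qed.

(** Each monomial is close to [c] up to the product of its signs, and these products sum to
    [qsym s e]. Both terms in the recursion of [qsym] carry an error, so the bound doubles with
    every index. *)
Lemma qsym_approx (T : eqType) (x : T -> R) (b c eps : R) (e : seq nat)
    (s : seq R) (j : seq T) :
  0 <= eps -> size s = size j -> (forall z, z \in s -> z = 1 \/ z = -1) ->
  (forall u, subseq u j -> size u = size e ->
     p (b * monom [seq x i | i <- u] e - c) <= eps) ->
  p (b * qsym [seq z.1 * x z.2 | z <- zip s j] e - c * qsym s e)
    <= 2 ^+ size s * eps.
Proof.
move=> eps0; elim: s j b e => [|z s IHs] [|i j] b e //=.
  move=> _ _ h; rewrite expr0 mul1r; case: e h => [|d e] h.
    by have := h [::] isT erefl; rewrite /= !mulr1.
  by rewrite !mulr0 subr0 (seminorm0 hp).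
case=> sj sg h.
have sg' y : y \in s -> y = 1 \/ y = -1 by move=> ys; apply: sg; rewrite inE ys orbT.
have h1 := IHs j b e sj sg' (fun u uj => h u (subseq_trans uj (subseq_cons _ _))).
rewrite exprS mulrDl mul1r mulrDl.
case: e h h1 => [|d e] h h1.
  by rewrite !addr0; apply: le_trans h1 _; rewrite lerDl mulr_ge0 // exprn_ge0.
set q := qsym [seq _ | _ <- _] e.
(* The factor of the chosen first index is absorbed into the coefficient [b]. *)
have h2 : p (b * x i ^+ d * q - c * qsym s e) <= 2 ^+ size s * eps.
  apply: IHs => // u uj su; have := h (i :: u); rewrite /= eqxx su mulrA.
  by apply.
rewrite [X in p X](_ : _ = (b * qsym [seq y.1 * x y.2 | y <- zip s j] (d :: e)
    - c * qsym s (d :: e)) + z ^+ d * (b * x i ^+ d * q - c * qsym s e)); last first.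
  by rewrite exprMn; ring.
apply: le_trans (seminormD hp _ _) _; rewrite seminorm_sign; last first.
  by apply: sg; rewrite mem_head.
exact: lerD.
Qed.

Lemma oddpolyE (l : nat) (a : 'I_l -> R) (x : R) :
  (oddpoly a).[x] = \sum_(j < l) a j * x ^+ j.*2.+1.
Proof.
by rewrite /oddpoly horner_sum; apply: eq_bigr => j _; rewrite hornerZ hornerXn.
Qed.

Lemma odd_poly_recurrence (l : nat) (a : 'I_l -> R) (eps : R) : 0 < eps ->
  exists N, forall r (n : 'I_r -> int), (N <= r)%N ->
  exists j : (2 ^ l).-tuple 'I_r, sorted <%O j /\
    p ((oddpoly a).[(iter_diff l [seq n i | i <- j])%:~R]) < eps.
Proof.
move=> eps0.
(* [L] lists the types of monomials in the expansion of [v]. Each contributes an error of at most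
   [2 ^+ (2 ^ l) * del], whence [B]; the summand 1 in [B + 1] makes the final inequality strict. *)
pose L := [seq (j, f) | j : 'I_l <- enum 'I_l, f : seq nat <- comps j.*2.+1].
pose B : R := (size L)%:R * 2 ^+ (2 ^ l).
have B0 : 0 <= B by rewrite mulr_ge0 // exprn_ge0.
pose del := eps / (B + 1).
have del0 : 0 < del by rewrite divr_gt0 // ltr_wpDl.
have [C [c hc]] := seminorm_tb hp del0.
have [N hN] := ramsey_seq C (fun z : 'I_l * seq nat => size z.2) L (2 ^ l).
exists N => r n Nr; pose x (i : 'I_r) : R := (n i)%:~R.
pose col (z : 'I_l * seq nat) (u : seq 'I_r) := c (a z.1 * monom [seq x i | i <- u] z.2).
have [|t [tr lt hom]] := hN _ col (enum 'I_r) (enum_uniq _); first by rewrite size_enum_ord.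
have st : size (take (2 ^ l) t) == (2 ^ l)%N by rewrite size_takel.
exists (Tuple st); split.
  apply: (@subseq_sorted _ _ _ _ (enum 'I_r)); first exact: lt_trans.
    by apply: subseq_trans tr; apply: take_subseq.
  have := iota_ltn_sorted 0 r; rewrite -val_enum_ord sorted_map.
  exact: sub_sorted.
set J := take _ _ in st *.
have sJ : size J = (2 ^ l)%N by apply/eqP.
pose y := [seq z.1 * x z.2 | z <- zip (morse R l) J].
have -> : (iter_diff l [seq n i | i <- J])%:~R = \sum_(v <- y) v :> R.
  rewrite iter_diff_morse ?size_map // rmorph_sum /= /y big_map.
  have -> : morse R l = [seq z%:~R | z <- morse int l].
    elim: (l) => //= k ->; rewrite map_cat -!map_comp; congr (_ ++ _).
    by apply: eq_map => z /=; rewrite rmorphN.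
  elim: (morse int l) (J) => [|z s IHs] [|i j]; rewrite ?big_nil //= !big_cons IHs.
  by rewrite rmorphM.
rewrite oddpolyE.
have -> : \sum_(j < l) a j * (\sum_(v <- y) v) ^+ j.*2.+1 = \sum_(z <- L) a z.1 * qsym y z.2.
  rewrite big_allpairs_dep big_enum; apply: eq_bigr => j _.
  by rewrite sum_exp_qsym mulr_sumr.
apply: le_lt_trans (seminorm_sum _ _) _.
have bnd z : z \in L -> p (a z.1 * qsym y z.2) <= 2 ^+ (2 ^ l) * del.
  move=> zL; have [c0 hc0] := hom z zL.
  have [cz hcz] : exists cz, forall u, subseq u J -> size u = size z.2 ->
      p (a z.1 * monom [seq x i | i <- u] z.2 - cz) <= del.
    have Jt u : subseq u J -> subseq u t.
      by move=> uJ; apply: subseq_trans uJ _; apply: take_subseq.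
    have [[u0 u0J su0]|h] := pselect (exists2 u0, subseq u0 J & size u0 = size z.2).
      exists (a z.1 * monom [seq x i | i <- u0] z.2) => u uJ su; apply: hc.
      by rewrite -/(col z u) -/(col z u0) !hc0 //; apply: Jt.
    (* If [J] has no sublist of the required length, any constant will do. *)
    by exists 0 => u uJ su; case: h; exists u.
  have := qsym_approx (ltW del0) _ (@morse_sign R l) hcz.
  rewrite size_morse sJ => /(_ erefl).
  case/allpairsPdep: zL => j [f [_ fj ->]] /=.
  have [sf af] := compsP fj.
  (* The weight 2 j + 1 is odd and below 2 l, so the unknown constant [cz] is multiplied by zero. *)
  rewrite (@qsym_morse _ l) // ?mulr0 ?subr0 // sf; last by have := ltn_ord j; lia.
  by rewrite /= odd_double.
rewrite big_seq; apply: le_lt_trans (ler_sum _ bnd) _.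
rewrite -big_seq big_const_seq count_predT iter_addr_0 -[_ *+ size L]mulr_natl mulrA -/B.
have -> : B * del = eps - del by rewrite /del; field; rewrite gt_eqF // ltr_wpDl.
by rewrite gtrBl.
Qed.

End Recurrence.

(** * Iterated differences along lacunary sequences *)

Lemma iter_diff_lacunary (l : nat) (m : seq int) : size m = (2 ^ l)%N ->
  sorted (fun x y : int => x *+ 2 <= y) m -> all (fun x => 0 < x) m ->
  head 0 m <= iter_diff l m <= last 0 m.
Proof.
elim: l m => [|l IHl] m; first by case: m => [|x []] //=; rewrite lexx.
rewrite expnS mul2n -addnn => sm.
have st : size (take (2 ^ l) m) = (2 ^ l)%N by rewrite size_takel // sm leq_addr.
have sd : size (drop (2 ^ l) m) = (2 ^ l)%N by rewrite size_drop sm addnK.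
have := cat_take_drop (2 ^ l) m.
move: (take _ m) (drop _ m) st sd => t d st sd <-; rewrite all_cat => + /andP[at_ ad].
rewrite [iter_diff _ _]/= take_size_cat // drop_size_cat //.
case: t st at_ => [|x t] st at_; first by have := expn_gt0 2 l; rewrite -st.
case: d sd ad => [|y d] sd ad; first by have := expn_gt0 2 l; rewrite -sd.
rewrite cat_cons /= cat_path /= last_cat /= => /and3P[st' xy sd'].
(* The two-sided bound carries the induction: the second half gives at least [y], hence at least
   twice the last entry of the first half, while the first half gives at most that entry. *)
have /andP[h1 h2] := IHl _ st st' at_; have /andP[h3 h4] := IHl _ sd sd' ad.
have x0 : 0 < x by case/andP: at_.
rewrite /= in h1 h2 h3 h4.
set u := iter_diff _ _ in h1 h2 *; set v := iter_diff _ _ in h3 h4 *.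
by rewrite !mulr2n in xy; lia.
Qed.

Lemma Delta0_star_Delta_star (l : nat) (E : set nat) :
  is_Delta0_star l E -> is_Delta_star l E.
Proof.
case=> Epos hE; split=> // n npos nlt.
have nk k : (k < n k)%N.
  by elim: k => [|k IHk]; [exact: npos|apply: leq_ltn_trans IHk _; apply: nlt].
(* As [n k > k], the index [2 * n (g k)] ensures that [n] at least doubles from [g k] to
   [g k.+1]. *)
pose g := fix g k := if k is k'.+1 then (2 * n (g k'))%N else 0%N.
have gS k : (2 * n (g k) <= n (g k.+1))%N by apply: ltnW; rewrite /= nk.
have glt k : (g k < g k.+1)%N.
  by rewrite /=; apply: leq_trans (nk _) _; rewrite leq_pmull.
have gmono i j : (i < j)%N -> (g i < g j)%N.
  exact: (homo_ltn ltn_trans glt).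
(* [F] collects the positive iterated differences of the whole sequence; the lacunary subsequence
   only serves to show that [F] is a Delta_{l,0} set. *)
pose F : set nat := [set k | posnat k /\ diff_set l (fun k => Posz (n k)) (Posz k)]%classic.
have F0 : is_Delta0 l F.
  split=> [k []//|r lr]; exists F; split=> //; split=> // [k []//|].
  exists (fun i : 'I_r => Posz (n (g i))) => _ [j [sj ->]].
  set m := [seq _ | _ <- _].
  have sm : size m = (2 ^ l)%N by rewrite size_map size_tuple.
  have sortm : sorted (fun x y : int => x *+ 2 <= y) m.
    rewrite /m sorted_map; apply: sub_sorted sj => i k /= ik.
    have : (n (g i.+1) <= n (g k))%N.
      have [->//|ltk] := eqVneq i.+1 k; apply/ltnW/nlt/gmono.
      by rewrite ltn_neqAle ltk.
    by move=> h; have := gS i; lia.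
  have posm : all (fun x => 0 < x) m.
    by rewrite /m all_map; apply/allP => i _ /=; have := npos (g i); rewrite /posnat /=; lia.
  have /andP[hm _] := iter_diff_lacunary sm sortm posm.
  have h0 : 0 < iter_diff l m.
    apply: lt_le_trans hm; case: (m) sm posm => [|x m' _ /= /andP[]//].
    by move=> s0; have := expn_gt0 2 l; rewrite -s0.
  exists `|iter_diff l m|%N; last by lia.
  split; first by rewrite /posnat /=; lia.
  have st : size [seq g i | i : 'I_r <- j] == (2 ^ l)%N by rewrite size_map size_tuple.
  exists (Tuple st); split; last first.
    by transitivity (iter_diff l m); [lia|rewrite /= -map_comp].
  by rewrite /= sorted_map; apply: sub_sorted sj => i k /= ik; apply: gmono.
have [k [Ek [kpos kD]]] := hE F F0.
by exists (Posz k); split=> //; exists k.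
Qed.

(** * Positive upper density *)

Definition dcount (S : pred nat) (N : nat) : nat := (\sum_(0 <= n < N) S n)%N.

(** Positive upper density without limits: the proportion of [S] below [N] is at least [1/d] for
    arbitrarily large [N]. *)
Definition posdens (S : pred nat) : Prop :=
  exists d, forall N0, exists2 N, (N0 <= N)%N & (N <= d * dcount S N)%N.

Lemma not_posdens (S : pred nat) (d : nat) : ~ posdens S ->
  exists N0, forall N, (N0 <= N)%N -> (d * dcount S N < N)%N.
Proof.
move=> S0; apply: contrapT => h; apply: S0; exists d => N0.
apply: contrapT => h'; apply: h; exists N0 => N N0N.
by rewrite ltnNge; apply/negP => hN; apply: h'; exists N.
Qed.

Lemma sub_posdens (S T : pred nat) : (forall n, S n -> T n) -> posdens S -> posdens T.
Proof.
move=> ST [d hd]; exists d => N0; have [N N0N hN] := hd N0; exists N => //.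
apply: leq_trans hN _; rewrite leq_mul2l; apply/orP; right; apply: leq_sum => n _.
by case: (S n) (ST n) => // ->.
Qed.

Lemma posdens_inhabited (S : pred nat) : posdens S -> exists n, S n.
Proof.
case=> d hd; have [N N1 hN] := hd 1%N; apply: contrapT => h.
have S0 : dcount S N = 0%N.
  by rewrite /dcount big1 // => n _; case E: (S n) => //; case: h; exists n.
by move: hN; rewrite S0 muln0; lia.
Qed.

Lemma dcount_le (S : pred nat) N : (dcount S N <= N)%N.
Proof.
rewrite -{2}(subn0 N) -[(N - 0)%N]muln1 -sum_nat_const_nat; apply: leq_sum => n _.
exact: leq_b1.
Qed.

Lemma dcountD (S : pred nat) N m :
  dcount S (m + N) = (dcount S m + dcount (fun n => S (n + m)) N)%N.
Proof.
rewrite /dcount (@big_cat_nat _ _ _ m) ?leq_addr //=; congr (_ + _)%N.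
by rewrite -[X in \sum_(X <= _ < _) _]add0n big_addn addKn.
Qed.

Lemma dcount_mono (S : pred nat) N m : (N <= m)%N -> (dcount S N <= dcount S m)%N.
Proof. by move=> /subnKC <-; rewrite dcountD leq_addr. Qed.

(** When [m] of the [b i] hold, this is the inequality m <= 1 + m (m - 1) / 2. *)
Lemma sum_bool_pairs (K : nat) (b : nat -> bool) :
  (\sum_(0 <= i < K) b i <= 1 + \sum_(0 <= j < K) \sum_(0 <= i < j) (b i && b j))%N.
Proof.
elim: K => [|K IHK]; first by rewrite !big_nil.
rewrite !big_nat_recr //=; case: (b K) => /=.
  rewrite addn1 add1n ltnS; apply: leq_trans (leq_addl _ _).
  by apply: leq_sum => i _; rewrite andbT.
by rewrite addn0 addnA; apply: leq_trans IHK (leq_addr _ _).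
Qed.

(** More translates than the inverse of the density cannot be pairwise disjoint up to density zero.
    [K] is chosen before the shifts [ms], which later makes the net of an orbit finite. *)
Lemma posdens_overlap (S : pred nat) : posdens S -> exists K, forall ms : nat -> nat,
  exists i j, [/\ (i < j)%N, (j < K)%N & posdens (fun n => S (n + ms i) && S (n + ms j))].
Proof.
case=> d hd; exists d.+2 => ms; set K := d.+2; apply: contrapT => h.
have hz i j : (i < j < K)%N -> ~ posdens (fun n => S (n + ms i) && S (n + ms j)).
  by move=> /andP[ij jK] hS; apply: h; exists i, j.
(* There are at most [K * K] pairs, so this factor keeps [d] times the sum of all overlaps below
   [N]. *)
pose D := (d * (K * K))%N.
have [N0 hN0] : exists N0, forall i j N, (i < j < K)%N -> (N0 <= N)%N ->
    (D * dcount (fun n => S (n + ms i) && S (n + ms j)) N < N)%N.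
  pose P (z : 'I_K * 'I_K) N0 := (z.1 < z.2)%N -> forall N, (N0 <= N)%N ->
    (D * dcount (fun n => S (n + ms z.1) && S (n + ms z.2)) N < N)%N.
  have /choice[f hf] : forall z, exists N0, P z N0.
    move=> [i j]; have [ij|ij] := boolP (i < j)%N; last by exists 0%N; rewrite /P /= (negPf ij).
    have [|N0 hN0] := @not_posdens _ D (hz i j _); first by rewrite ij ltn_ord.
    by exists N0 => _ N; apply: hN0.
  exists (\max_z f z)%N => i j N /andP[ij jK] hN.
  have iK := ltn_trans ij jK.
  apply: (hf (Ordinal iK, Ordinal jK)) => //; apply: leq_trans hN.
  exact: leq_bigmax.
pose M := (\sum_(0 <= i < K) ms i)%N.
have [N hN1 hN2] := hd (N0 + (d * M).+1)%N.
have le1 : (K * dcount S N <= M + \sum_(0 <= i < K) dcount (fun n => S (n + ms i)) N)%N.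
  rewrite -[X in (X * _)%N]subn0 -sum_nat_const_nat -big_split; apply: leq_sum => i _ /=.
  apply: leq_trans (_ : dcount S (ms i + N) <= _)%N; first by rewrite dcount_mono ?leq_addl.
  by rewrite dcountD leq_add2r dcount_le.
have le2 : (\sum_(0 <= i < K) dcount (fun n => S (n + ms i)) N <=
    N + \sum_(0 <= j < K) \sum_(0 <= i < j) dcount (fun n => S (n + ms i) && S (n + ms j)) N)%N.
  rewrite /dcount exchange_big /=.
  under [X in (_ + X)%N]eq_bigr do rewrite exchange_big /=.
  rewrite [X in (_ + X)%N]exchange_big /=.
  rewrite [X in leq _ (X + _)](_ : N = \sum_(0 <= n < N) 1)%N -?big_split; last first.
    by rewrite sum_nat_const_nat subn0 muln1.
  by apply: leq_sum => n _; apply: (sum_bool_pairs K (fun i => S (n + ms i))).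
have le3 : (d * (\sum_(0 <= j < K) \sum_(0 <= i < j)
     dcount (fun n => S (n + ms i) && S (n + ms j)) N) <= N)%N.
  have [->//|d0] := posnP d.
  rewrite -(@leq_pmul2l (K * K)) // mulnA [(K * K * d)%N]mulnC -/D.
  apply: leq_trans (_ : \sum_(0 <= j < K) \sum_(0 <= i < K) N <= _)%N; last first.
    by rewrite !sum_nat_const_nat !subn0 mulnA.
  rewrite big_distrr /= big_nat [in leqRHS]big_nat; apply: leq_sum => j /andP[_ jK].
  rewrite big_distrr /= [leqRHS](@big_cat_nat _ _ _ j) ?(ltnW jK) //=.
  apply: leq_trans (leq_addr _ _).
  rewrite big_nat [in leqRHS]big_nat; apply: leq_sum => i /andP[_ ij].
  by apply/ltnW/hN0; [rewrite ij|apply: leq_trans hN1; rewrite leq_addr].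
move: le1 le2 le3 hN1 hN2; set A := dcount S N; set B := (\sum_(_ <= _ < _) dcount _ _)%N.
set C := (\sum_(_ <= _ < _) \sum_(_ <= _ < _) _)%N => le1 le2 le3 hN1 hN2.
have : (K * N <= d * (K * A))%N by rewrite mulnCA leq_mul2l hN2 orbT.
have : (d * (K * A) <= d * (M + (N + C)))%N.
  by rewrite leq_mul2l; apply/orP; right; apply: leq_trans le1 _; rewrite leq_add2l.
(* With [K = d + 2] the estimates give [(d + 2) * N <= d * M + d * N + N], that is [N <= d * M],
   against the choice of [N]. *)
rewrite /K; nia.
Qed.

(** Finitely many translates of a set of density zero cannot cover the natural numbers. *)
Lemma not_posdens_avoid (S : pred nat) (ms : seq nat) : ~ posdens S ->
  exists n, forall m, m \in ms -> ~~ S (n + m)%N.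
Proof.
(* The factor 2 pays for counting up to [2 * N], a range that contains every translate of the window
   below [N]. *)
move=> S0; have [N0 hN0] := not_posdens (2 * (size ms).+1) S0.
apply: contrapT => h.
have hn n : (1 <= \sum_(m <- ms) S (n + m))%N.
  have [m mm Sm] : exists2 m, m \in ms & S (n + m).
    apply: contrapT => hm; apply: h; exists n => m mms; apply/negP => Sm.
    by apply: hm; exists m.
  by rewrite (big_rem m) //= Sm.
pose N := (N0 + (\sum_(m <- ms) m).+1)%N.
have : (\sum_(0 <= n < N) 1 <= \sum_(0 <= n < N) \sum_(m <- ms) S (n + m))%N.
  exact: leq_sum.
rewrite sum_nat_const_nat muln1 subn0 exchange_big /=.
apply/negP; rewrite -ltnNge.
apply: leq_ltn_trans (_ : size ms * dcount S (2 * N) < _)%N.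
  have -> : (size ms * dcount S (2 * N) = \sum_(m <- ms) dcount S (2 * N))%N.
    by rewrite big_const_seq count_predT iter_addn_0 mulnC.
  rewrite big_seq [leqRHS]big_seq; apply: leq_sum => m mms.
  apply: leq_trans (_ : dcount S (m + N) <= _)%N; first by rewrite dcountD leq_addl.
  apply: dcount_mono; rewrite mul2n -addnn leq_add2r.
  rewrite /N (big_rem m) //=; lia.
have := hN0 (2 * N)%N; rewrite -mulnA ltn_pmul2l // mulSn => hh.
apply: leq_ltn_trans (hh _); [exact: leq_addl|rewrite /N; lia].
Qed.

Lemma iter_diff_rcons (l : nat) (u : seq int) (x : int) : (size u).+1 = (2 ^ l)%N ->
  iter_diff l (rcons u x) = x + iter_diff l (rcons u 0).
Proof.
elim: l u => [|l IHl] u /=; first by case: u => //=; rewrite addr0.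
rewrite expnS mul2n -addnn => su.
have l0 : (0 < 2 ^ l)%N by rewrite expn_gt0.
have lu : (2 ^ l <= size u)%N by lia.
rewrite !drop_rcons // -!cats1 !takel_cat // !cats1.
by rewrite IHl ?addrA // size_drop; lia.
Qed.

Lemma greedy_sequence (T : Type) (P : seq T -> T -> Prop) :
  (forall s, exists x, P s x) -> exists n : nat -> T, forall k, P (mkseq n k) (n k).
Proof.
move=> /choice[next hnext].
pose L := fix L k := if k is k'.+1 then rcons (L k') (next (L k')) else [::].
exists (fun k => next (L k)) => k.
suff -> : mkseq (fun k => next (L k)) k = L k by apply: hnext.
by elim: k => //= k IHk; rewrite mkseqS IHk.
Qed.

Lemma Delta_star_posdens (l : nat) (E : set nat) :
  is_Delta_star l E -> posdens (fun n => `[< E n >]).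
Proof.
case=> Epos hE; apply: contrapT => E0.
(* The last entry has sign +1, so an iterated difference ending in [next] equals [next + c pre u],
   and [next] has to avoid only finitely many translates of [E]. *)
pose c (pre : seq nat) (u : (2 ^ l).-1.-tuple 'I_(size pre)) : int :=
  iter_diff l (rcons [seq Posz (nth 0%N pre (val i)) | i <- u] 0).
have /greedy_sequence[n hn] : forall pre, exists next,
    [/\ forall x, x \in pre -> (x < next)%N, (0 < next)%N &
    forall u k, Posz next + @c pre u = Posz k -> ~ E k].
  move=> pre.
  (* [B] exceeds all earlier terms and makes every [B + c pre u] nonnegative, so that [absz] does
     not change it. *)
  pose B := ((\sum_(x <- pre) x).+1 + \sum_u `|@c pre u|)%N.
  have hB u : (`|@c pre u| <= B)%N.
    by rewrite /B (bigD1 u) //=; lia.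
  have [n hn] := not_posdens_avoid [seq absz (Posz B + @c pre u) |
    u <- enum {: (2 ^ l).-1.-tuple 'I_(size pre)}] E0.
  exists (n + B)%N; split.
  - by move=> x xp; rewrite /B (big_rem x) //=; lia.
  - by rewrite /B; lia.
  move=> u k hk Ek.
  have /hn/asboolP : absz (Posz B + @c pre u) \in
      [seq absz (Posz B + @c pre u) | u <- enum {: (2 ^ l).-1.-tuple 'I_(size pre)}].
    by apply: map_f; rewrite mem_enum.
  apply; rewrite (_ : (n + _)%N = k) //.
  by have := hB u; lia.
have nL k i : (i < k)%N -> nth 0%N (mkseq n k) i = n i by move=> ik; rewrite nth_mkseq.
have npos k : posnat (n k) by case: (hn k).
have nlt i j : (i < j)%N -> (n i < n j)%N.
  move=> ij; have [h _ _] := hn j; apply: h.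
  by rewrite -(nL j i ij) mem_nth // size_mkseq.
have [_ [[k Ek <-] [j [sj]]]] := hE n npos nlt.
have sj2 : size j = (2 ^ l)%N by rewrite size_tuple.
case/lastP: {j}(tval j) sj sj2 => [|u x] sj.
  by move=> /= s0; have := expn_gt0 2 l; rewrite -s0.
rewrite size_rcons map_rcons => su hk.
rewrite iter_diff_rcons ?size_map // in hk.
have ux i : i \in u -> (i < x)%N.
  move=> iu; have : subseq [:: i; x] (rcons u x).
    by rewrite -cats1 -[[:: i; x]]cat1s cat_subseq // sub1seq.
  move=> /(subseq_sorted (@lt_trans _ _)) /(_ sj) /=; by rewrite andbT.
have [_ _ h] := hn x.
have [v hv] : exists v : seq 'I_(size (mkseq n x)), [seq val i | i <- v] = u.
  elim: u {sj su hk} ux => [|i u IHu] ux; first by exists [::].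
  have [k' k'u|v vE] := IHu; first by apply: ux; rewrite inE k'u orbT.
  have ix : (i < size (mkseq n x))%N by rewrite size_mkseq ux ?mem_head.
  by exists (Ordinal ix :: v); rewrite /= vE.
have sv : size v == (2 ^ l).-1 by rewrite -su /= -hv size_map.
apply: (h (Tuple sv) k) Ek; rewrite hk /c /= -hv -map_comp.
congr (_ + iter_diff l (rcons _ _)).
by apply: eq_map => i /=; rewrite nL // -{2}(size_mkseq n x).
Qed.

(** * Inner products and unitary operators *)

Section InnerProduct.
Variables (R : realType) (H : completeNormedModType R[i]).
Variables (dot : {dot H for Num.conj}) (hdot : is_inner_product dot).
Implicit Types (x y z : H) (c : R[i]).

(** The norm takes values in [R[i]]; its real part is the same norm in [R], where real arithmetic
    applies. *)
Definition nm (V : normedModType R[i]) (x : V) : R := complex.Re `|x|.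

Section Norm.
Variable V : normedModType R[i].
Implicit Types (u v : V).

Lemma nmE u : `|u| = (nm u)%:C%C.
Proof. by rewrite /nm RRe_real // ger0_real. Qed.

Lemma nm_ge0 u : 0 <= nm u.
Proof. by rewrite -(lecR 0) -nmE normr_ge0. Qed.

Lemma nm_lt u (e : R) : (`|u| < e%:C%C) = (nm u < e).
Proof. by rewrite nmE ltcR. Qed.

Lemma nm0 : nm (0 : V) = 0.
Proof. by rewrite /nm normr0. Qed.

Lemma nm0_eq0 u : nm u = 0 -> u = 0.
Proof. by move=> u0; apply/eqP; rewrite -normr_eq0 nmE u0. Qed.

Lemma nm_eq0 u : (nm u == 0) = (u == 0).
Proof. by apply/eqP/eqP => [/nm0_eq0|->]; rewrite ?nm0. Qed.

Lemma nm_gt0 u : (0 < nm u) = (u != 0).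
Proof. by rewrite lt_def nm_ge0 andbT nm_eq0. Qed.

Lemma nmN u : nm (- u) = nm u.
Proof. by rewrite /nm normrN. Qed.

Lemma nmD u v : nm (u + v) <= nm u + nm v.
Proof. by rewrite -lecR rmorphD /= -!nmE ler_normD. Qed.

Lemma nmB u v : nm (u - v) <= nm u + nm v.
Proof. by rewrite -(nmN v) nmD. Qed.

Lemma nm_distC u v : nm (u - v) = nm (v - u).
Proof. by rewrite -nmN opprB. Qed.

Lemma nm_triangle w u v : nm (u - v) <= nm (u - w) + nm (w - v).
Proof. by apply: le_trans (nmD _ _); rewrite addrA subrK. Qed.

Lemma nm_sum (I : Type) (r : seq I) (P : pred I) (F : I -> V) :
  nm (\sum_(i <- r | P i) F i) <= \sum_(i <- r | P i) nm (F i).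
Proof.
elim/big_rec2: _ => [|i y x _ h]; first by rewrite nm0.
by apply: le_trans (nmD _ _) _; rewrite lerD2l.
Qed.

End Norm.

Definition cm (c : R[i]) : R := complex.Re `|c|.

Lemma cmE c : `|c| = (cm c)%:C%C.
Proof. by rewrite /cm RRe_real // ger0_real. Qed.

Lemma cm_ge0 c : 0 <= cm c.
Proof. by rewrite -(lecR 0) -cmE normr_ge0. Qed.

Lemma cmD c1 c2 : cm (c1 + c2) <= cm c1 + cm c2.
Proof. by rewrite -lecR rmorphD /= -!cmE ler_normD. Qed.

Lemma cmN c : cm (- c) = cm c.
Proof. by rewrite /cm normrN. Qed.

Lemma cm0 : cm 0 = 0.
Proof. by rewrite /cm normr0. Qed.

Lemma cm1 : cm 1 = 1.
Proof. by rewrite /cm normr1. Qed.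

Lemma cmM c1 c2 : cm (c1 * c2) = cm c1 * cm c2.
Proof. by apply: complexI; rewrite rmorphM /= -!cmE normrM. Qed.

Lemma cmX c n : cm (c ^+ n) = cm c ^+ n.
Proof. by elim: n => [|n IHn]; rewrite ?expr0 ?cm1 // !exprS cmM IHn. Qed.

Lemma cm_eq0 c : (cm c == 0) = (c == 0).
Proof. by rewrite -(inj_eq (@complexI R)) -cmE normr_eq0. Qed.

Lemma cmV c : cm c^-1 = (cm c)^-1.
Proof. by apply: complexI; rewrite fmorphV /= -!cmE normfV. Qed.

Lemma cm_real (a : R) : cm a%:C%C = `|a|.
Proof. by rewrite /cm normc_def /= expr0n addr0 sqrtr_sqr. Qed.

Lemma cm_nat n : cm n%:R = n%:R.
Proof. by rewrite -(rmorph_nat (real_complex R)) cm_real normr_nat. Qed.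

Lemma cm_sum (I : Type) (r : seq I) (P : pred I) (F : I -> R[i]) :
  cm (\sum_(i <- r | P i) F i) <= \sum_(i <- r | P i) cm (F i).
Proof.
elim/big_rec2: _ => [|i y x _ h]; first by rewrite cm0.
by apply: le_trans (cmD _ _) _; rewrite lerD2l.
Qed.

Lemma cm_sqr c : (cm c ^+ 2)%:C%C = c * c^*.
Proof. by rewrite rmorphXn /= -cmE normCK. Qed.

Lemma cm_sqrE c : cm c ^+ 2 = complex.Re c ^+ 2 + complex.Im c ^+ 2.
Proof. by apply: complexI; rewrite rmorphXn /= -cmE -add_Re2_Im2. Qed.

Lemma Re_le_cm c : complex.Re c <= cm c.
Proof.
have := normc_ge_Re c; rewrite cmE lecR; apply: le_trans; exact: ler_norm.
Qed.

Lemma nmZ (V : normedModType R[i]) c (u : V) : nm (c *: u) = cm c * nm u.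
Proof. by apply: complexI; rewrite rmorphM /= -nmE -cmE -nmE normrZ. Qed.

Lemma dotC x y : dot x y = (dot y x)^*.
Proof. by have := @hermC _ _ _ _ dot x y; rewrite expr0 mul1r. Qed.

Lemma dotxx x : dot x x = (nm x ^+ 2)%:C%C.
Proof. by rewrite -hdot nmE -rmorphXn. Qed.

Lemma dotZl c x y : dot (c *: x) y = c * dot x y.
Proof. by rewrite linearZl_LR. Qed.

Lemma dotZr c x y : dot x (c *: y) = c^* * dot x y.
Proof. by rewrite linearZr_LR. Qed.

Lemma nm_sqrD x y : nm (x + y) ^+ 2 = nm x ^+ 2 + nm y ^+ 2 + 2 * complex.Re (dot x y).
Proof.
apply: complexI; rewrite -dotxx linearDl /= !linearDr /= !dotxx (dotC y x).
rewrite !rmorphD /= (rmorphM (real_complex R) 2) /= (rmorph_nat (real_complex R)) -addcJ.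
ring.
Qed.

Lemma nm_sqrB x y : nm (x - y) ^+ 2 = nm x ^+ 2 + nm y ^+ 2 - 2 * complex.Re (dot x y).
Proof. by rewrite nm_sqrD nmN linearNr /= raddfN mulrN. Qed.

Lemma parallelogram x y :
  nm (x + y) ^+ 2 + nm (x - y) ^+ 2 = 2 * nm x ^+ 2 + 2 * nm y ^+ 2.
Proof. by rewrite nm_sqrD nm_sqrB; ring. Qed.

(** Pythagoras for the projection on the line of [y]. Cauchy-Schwarz, the orthogonality of a
    nearest-point residual and the eigenvector criterion all rest on it. *)
Lemma nm_sqr_proj x y : y != 0 ->
  nm (x - (dot x y / dot y y) *: y) ^+ 2 = nm x ^+ 2 - cm (dot x y) ^+ 2 / nm y ^+ 2.
Proof.
move=> y0; have ny : nm y != 0 by rewrite nm_eq0.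
rewrite nm_sqrB nmZ dotZr exprMn cmM cmV dotxx cm_real ger0_norm ?sqr_ge0 //.
have -> : (dot x y / (nm y ^+ 2)%:C%C)^* * dot x y = (cm (dot x y) ^+ 2 / nm y ^+ 2)%:C%C.
  rewrite (rmorphM (real_complex R) (cm _ ^+ 2)) /= cm_sqr fmorphV /=.
  rewrite (rmorphM _ (dot x y)) fmorphV /= mulrAC; congr (_ / _).
    by rewrite mulrC.
  by rewrite conj_Creal // complex_real.
rewrite /=; field.
by [].
Qed.

Lemma cauchy_schwarz x y : cm (dot x y) <= nm x * nm y.
Proof.
have [->|y0] := eqVneq y 0; first by rewrite linear0r nm0 mulr0 cm0.
rewrite -(@ler_pXn2r _ 2) ?nnegrE ?mulr_ge0 ?nm_ge0 ?cm_ge0 // exprMn.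
have ny : 0 < nm y ^+ 2 by rewrite exprn_gt0 // nm_gt0.
by rewrite -ler_pdivrMr // -subr_ge0 -nm_sqr_proj // sqr_ge0.
Qed.

End InnerProduct.

(** * The degree of the difference of a polynomial and its translate *)

Section ShiftDiff.
Variable R : realFieldType.
Implicit Types p q : {poly R}.

Lemma size_shift_diff_le q (h : R) n :
  (size q <= n.+1)%N -> (size (q \Po ('X + h%:P) - q)%R <= n)%N.
Proof.
move=> sq; have sXh : size ('X + h%:P) = 2%N by rewrite size_XaddC.
have [->|q0] := eqVneq q 0; first by rewrite comp_poly0 subr0 size_poly0.
have sq' : (size (q \Po ('X + h%:P)%R) <= n.+1)%N by rewrite size_comp_poly2.
apply/leq_sizeP => j nj; rewrite coefB.
have [jn|nj'] := eqVneq j n; last first.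
  have nj1 : (n < j)%N by rewrite ltn_neqAle eq_sym nj'.
  by rewrite !nth_default ?subr0 //; [apply: leq_trans sq _|apply: leq_trans sq' _].
have [sqn|sqn] := eqVneq (size q) n.+1; last first.
  have sqn' : (size q <= n)%N by rewrite -ltnS ltn_neqAle sqn.
  by rewrite jn !nth_default ?subr0 ?size_comp_poly2.
have := lead_coef_comp q (_ : (1 < size ('X + h%:P)%R)%N).
rewrite sXh => /(_ isT); rewrite !lead_coefE size_comp_poly2 // sqn sXh /=.
by rewrite coefD coefX coefC /= addr0 expr1n mulr1 jn => ->; rewrite subrr.
Qed.

Lemma size_shift_diff p (h : R) d : h != 0 -> size p = d.+2 ->
  size (p \Po ('X + h%:P) - p) = d.+1.
Proof.
move=> h0 sp; pose c := lead_coef p; pose q := p - c *: 'X^(d.+1).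
have c0 : c != 0 by rewrite lead_coef_eq0 -size_poly_eq0 sp.
have sq : (size q <= d.+1)%N.
  apply/leq_sizeP => j dj; rewrite coefB coefZ coefXn.
  have [->|jd] := eqVneq j d.+1; first by rewrite mulr1 /c lead_coefE sp subrr.
  by rewrite mulr0 subr0 nth_default // sp; lia.
(* Factoring [h] out of (X + h)^(d+1) - X^(d+1) isolates the part of top degree, with leading
   coefficient [c * h * (d + 1)], nonzero in characteristic zero. *)
have -> : p \Po ('X + h%:P) - p =
    (c * h) *: (\sum_(i < d.+1) ('X + h%:P) ^+ (d - i) * 'X^i) + (q \Po ('X + h%:P) - q).
  have -> : p = c *: 'X^(d.+1) + q by rewrite addrC subrK.
  rewrite comp_polyD comp_polyZ comp_Xn_poly opprD addrACA -scalerBr; congr (_ + _).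
  rewrite subrXX /= [X in X - _]addrC addrK -scalerA; congr (_ *: _).
  by rewrite mul_polyC.
set Q := q \Po _ - q; set S := \sum_(i < _) _.
have sQ : (size Q <= d)%N by apply: size_shift_diff_le.
have mon (i : 'I_d.+1) : size (('X + h%:P) ^+ (d - i) * 'X^i) = d.+1 /\
    (('X + h%:P) ^+ (d - i) * 'X^i)`_d = 1.
  have m1 : ('X + h%:P) ^+ (d - i) \is monic by rewrite monic_exp // monicXaddC.
  have m2 : ('X + h%:P) ^+ (d - i) * 'X^i \is monic by rewrite monicMl // monicXn.
  have s1 : size (('X + h%:P) ^+ (d - i) * 'X^i) = d.+1.
    rewrite size_monicM ?monic_neq0 ?monicXn // size_polyXn.
    have -> : size (('X + h%:P) ^+ (d - i)) = (d - i).+1.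
      by rewrite -[h]opprK polyCN size_exp_XsubC.
    by have := ltn_ord i; lia.
  by split=> //; move/monicP: m2; rewrite lead_coefE s1.
have Sd : S`_d = d.+1%:R.
  rewrite coef_sum; under eq_bigr do rewrite (mon _).2.
  by rewrite sumr_const card_ord.
have sS : (size S <= d.+1)%N.
  apply/leq_sizeP => j dj; rewrite coef_sum big1 // => i _.
  by rewrite nth_default // (mon i).1.
apply/eqP; rewrite eqn_leq; apply/andP; split.
  apply/leq_sizeP => j dj; rewrite coefD coefZ !nth_default ?mulr0 ?addr0 //.
    by apply: leq_trans dj; apply: leq_trans sQ _.
  exact: leq_trans dj.
rewrite ltnNge; apply/negP => /leq_sizeP /(_ d (leqnn d)) /eqP.
rewrite coefD coefZ Sd (nth_default _ sQ) addr0.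
by rewrite !mulf_eq0 (negPf c0) (negPf h0) pnatr_eq0.
Qed.

End ShiftDiff.

(** * Characters of the real line *)

Section Circle.
Variable R : realType.

Definition ex (t : R) : R[i] := (cos t +i* sin t)%C.

Lemma ex0 : ex 0 = 1.
Proof. by rewrite /ex cos0 sin0. Qed.

Lemma exD s t : ex (s + t) = ex s * ex t.
Proof. by rewrite /ex cosD sinD; simpc; congr (_ +i* _)%C; ring. Qed.

Lemma cm_ex t : cm (ex t) = 1.
Proof.
by apply/eqP; rewrite -(@eqrXn2 _ 2) ?cm_ge0 // cm_sqrE /= cos2Dsin2 expr1n.
Qed.

Lemma exN t : ex (- t) * ex t = 1.
Proof. by rewrite -exD addNr ex0. Qed.

Lemma cm1_ex (c : R[i]) : cm c = 1 -> exists t, c = ex t.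
Proof.
move=> c1; have : complex.Re c ^+ 2 + complex.Im c ^+ 2 = 1 by rewrite -cm_sqrE c1 expr1n.
case: c {c1} => a b /= ab.
have a1 : -1 <= a <= 1 by nra.
have [b0|b0] := leP 0 b.
  exists (acos a); rewrite /ex acosK ?in_itv // sin_acos //.
  by rewrite (_ : 1 - a ^+ 2 = b ^+ 2) ?sqrtr_sqr ?ger0_norm //; lra.
exists (- acos a); rewrite /ex cosN sinN acosK ?in_itv // sin_acos //.
by rewrite (_ : 1 - a ^+ 2 = b ^+ 2) ?sqrtr_sqr ?ltr0_norm ?opprK //; lra.
Qed.

Lemma grid_real (B eps : R) : 0 <= B -> 0 < eps -> exists (M : nat) (c : R -> 'I_M.+1),
  forall x y, `|x| <= B -> `|y| <= B -> c x = c y -> `|x - y| <= eps.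
Proof.
move=> B0 e0; pose M := Num.truncn (2 * B / eps).
exists M, (fun x => inord (Num.truncn ((x + B) / eps))) => x y xB yB.
have tr w : `|w| <= B -> [/\ 0 <= (w + B) / eps & (Num.truncn ((w + B) / eps) < M.+1)%N].
  rewrite ler_norml => /andP[w1 w2]; split; first by apply: divr_ge0; [lra|exact: ltW].
  by rewrite ltnS le_truncn // ler_pM2r ?invr_gt0 //; lra.
have [x0 xM] := tr x xB; have [y0 yM] := tr y yB.
move/(congr1 val); rewrite /= !inordK // => xy.
have /andP[h1 h2] := truncn_itv x0; have /andP[h3 h4] := truncn_itv y0.
rewrite xy in h1 h2; rewrite -natr1 in h2 h4.
have : `|(x + B) / eps - (y + B) / eps| <= 1 by rewrite ler_norml; lra.
rewrite -mulrBl normrM normfV [in X in _ / X]gtr0_norm // ler_pdivrMr // mul1r.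
by rewrite opprD addrACA subrr addr0.
Qed.

Lemma cm_le_ReIm (c : R[i]) : cm c <= `|complex.Re c| + `|complex.Im c|.
Proof.
rewrite -(@ler_pXn2r _ 2) ?nnegrE ?addr_ge0 ?cm_ge0 // cm_sqrE sqrrD !real_normK ?num_real //.
by rewrite lerD2r lerDl mulrn_wge0 // mulr_ge0.
Qed.

Lemma ReIm_le_cm (c : R[i]) : `|complex.Re c| <= cm c /\ `|complex.Im c| <= cm c.
Proof.
have a0 := cm_ge0 c; have h := cm_sqrE c.
by split; rewrite -(@ler_pXn2r _ 2) ?nnegrE ?cm_ge0 ?normr_ge0 // h real_normK ?num_real //;
  rewrite ?lerDl ?lerDr sqr_ge0.
Qed.

Lemma grid_complex (B eps : R) : 0 <= B -> 0 < eps ->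
  exists (C : finType) (c : R[i] -> C),
  forall x y, cm x <= B -> cm y <= B -> c x = c y -> cm (x - y) <= eps.
Proof.
move=> B0 e0; have e20 : 0 < eps / 2 by rewrite divr_gt0.
have [M [c hc]] := grid_real B0 e20.
exists ('I_M.+1 * 'I_M.+1)%type, (fun z => (c (complex.Re z), c (complex.Im z))).
move=> x y xB yB [c1 c2]; apply: le_trans (cm_le_ReIm _) _; rewrite !raddfB /=.
have [xr xi] := ReIm_le_cm x; have [yr yi] := ReIm_le_cm y.
rewrite (splitr eps); apply: lerD; apply: hc => //.
all: by [apply: le_trans xr xB|apply: le_trans yr yB|apply: le_trans xi xB|apply: le_trans yi yB].
Qed.

(** Total boundedness comes from compactness of the torus: [x] is coloured by the grid cells of the
    points [ex (x * t i)], and a rotation carries the pair of points of [x] and [y] to that of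
    [x - y] and 0. *)
Lemma char_seminorm n (K t : 'I_n -> R) : (forall i, 0 <= K i) ->
  seminorm (fun x : R => \sum_(i < n) K i * cm (ex (x * t i) - 1)).
Proof.
move=> K0; split.
- by rewrite big1 // => i _; rewrite mul0r ex0 subrr cm0 mulr0.
- move=> x; apply: eq_bigr => i _; congr (_ * _); rewrite mulNr.
  rewrite -[LHS]mul1r -(cm_ex (x * t i)) -cmM mulrBr mulr1 mulrC exN -cmN opprB //.
- move=> x y; rewrite -big_split /=; apply: ler_sum => i _; rewrite -mulrDr.
  apply: ler_wpM2l => //; rewrite mulrDl exD.
  have -> : ex (x * t i) * ex (y * t i) - 1 =
     ex (x * t i) * (ex (y * t i) - 1) + (ex (x * t i) - 1) by ring.
  by apply: le_trans (cmD _ _) _; rewrite cmM cm_ex mul1r addrC.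
move=> eps eps0.
pose S := \sum_(i < n) K i; have S0 : 0 <= S by apply: sumr_ge0.
have d0 : 0 < eps / (S + 1) by rewrite divr_gt0 // ltr_wpDl.
have [C [c hc]] := grid_complex ler01 d0.
exists {ffun 'I_n -> C}, (fun x => [ffun i => c (ex (x * t i))]) => x y /ffunP cxy.
apply: le_trans (_ : S * (eps / (S + 1)) <= _); last first.
  rewrite mulrCA -[leRHS]mulr1; apply: ler_wpM2l; first exact: ltW.
  by rewrite ler_pdivrMr ?ltr_wpDl // mul1r lerDl.
rewrite /S mulr_suml; apply: ler_sum => i _; apply: ler_wpM2l => //.
have := cxy i; rewrite !ffunE => /hc; rewrite !cm_ex => /(_ (lexx _) (lexx _)).
rewrite -[X in X <= _ -> _]mul1r -(cm_ex (- (y * t i))) -cmM mulrBr exN -exD.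
by rewrite [- _ + _]addrC -mulrBl.
Qed.

End Circle.

(** * Powers of a unitary operator, and recurrence under discrete spectrum *)

Section Unitary.
Variables (R : realType) (H : completeNormedModType R[i]).
Variables (dot : {dot H for Num.conj}) (hdot : is_inner_product dot).
Variable U : unitary dot.
Implicit Types (x y : H) (z : int).

Lemma dotU x y : dot (U x) (U y) = dot x y.
Proof. by rewrite uadjP uopK. Qed.

Lemma uadjD x y : uadj U (x + y) = uadj U x + uadj U y.
Proof. by apply: (can_inj (uopK U)); rewrite linearD /= !uadjK. Qed.

Lemma uadjZ c x : uadj U (c *: x) = c *: uadj U x.
Proof. by apply: (can_inj (uopK U)); rewrite linearZ /= !uadjK. Qed.

Lemma nmU x : nm (U x) = nm x.
Proof.
apply/eqP; rewrite -(@eqrXn2 _ 2) ?nm_ge0 //; apply/eqP.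
by apply: complexI; rewrite -!(dotxx hdot) dotU.
Qed.

Lemma nm_uadj x : nm (uadj U x) = nm x.
Proof. by rewrite -[in RHS](uadjK U x) nmU. Qed.

Lemma upowS z x : upow U (z + 1) x = U (upow U z x).
Proof.
case: z => [n|[|n]]; first by rewrite -PoszD addn1.
  by rewrite /= uadjK.
have -> : Negz n.+1 + 1 = Negz n by rewrite !NegzE; lia.
by rewrite /= uadjK.
Qed.

Lemma upow_pred z x : upow U (z - 1) x = uadj U (upow U z x).
Proof. by rewrite -[in RHS](subrK 1 z) upowS uopK. Qed.

Lemma upowD z1 z2 x : upow U (z1 + z2) x = upow U z1 (upow U z2 x).
Proof.
elim: z1 => [|n IHn|n IHn]; first by rewrite add0r.
  by rewrite intS [1 + _]addrC addrAC !upowS IHn.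
by rewrite intS opprD [- 1 + _]addrC addrAC !upow_pred IHn.
Qed.

Lemma upow_nat n x : upow U (Posz n) x = iter n U x.
Proof. by []. Qed.

Lemma upow_add z x y : upow U z (x + y) = upow U z x + upow U z y.
Proof.
by elim: z => [|n IHn|n IHn] //;
  rewrite intS ?opprD [X in upow U X]addrC ?upowS ?upow_pred IHn ?linearD ?uadjD.
Qed.

Lemma upow_scale z c x : upow U z (c *: x) = c *: upow U z x.
Proof.
by elim: z => [|n IHn|n IHn] //;
  rewrite intS ?opprD [X in upow U X]addrC ?upowS ?upow_pred IHn ?linearZ ?uadjZ.
Qed.

Lemma upow_sub z x y : upow U z (x - y) = upow U z x - upow U z y.
Proof. by rewrite upow_add -[- y]scaleN1r upow_scale scaleN1r. Qed.

Lemma upow_sum z (I : Type) (r : seq I) (F : I -> H) :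
  upow U z (\sum_(i <- r) F i) = \sum_(i <- r) upow U z (F i).
Proof.
elim: r => [|i r IHr]; last by rewrite !big_cons upow_add IHr.
by rewrite !big_nil -{1}(scale0r (0 : H)) upow_scale scale0r.
Qed.

Lemma nm_upow z x : nm (upow U z x) = nm x.
Proof.
by elim: z => [|n IHn|n IHn] //;
  rewrite intS ?opprD [X in upow U X]addrC ?upowS ?upow_pred ?nmU ?nm_uadj IHn.
Qed.

Lemma nm_upow_dist z1 z2 x : nm (upow U z1 x - upow U z2 x) = nm (upow U (z1 - z2) x - x).
Proof. by rewrite -(nm_upow z2 (_ - x)) upow_sub -upowD [z2 + _]addrC subrK. Qed.

Lemma eigenvalue_cm (x : H) (c : R[i]) : x != 0 -> U x = c *: x -> cm c = 1.
Proof.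
move=> x0 /(congr1 (@nm R H)); rewrite nmU nmZ => h.
by apply: (mulIf (_ : nm x != 0)); rewrite ?nm_eq0 // mul1r.
Qed.

Lemma upow_eigen (x : H) (t : R) z : U x = ex t *: x -> upow U z x = ex (z%:~R * t) *: x.
Proof.
move=> Ux; have Ax : uadj U x = ex (- t) *: x.
  by apply: (can_inj (uopK U)); rewrite uadjK linearZ /= Ux scalerA exN scale1r.
elim: z => [|n IHn|n IHn]; first by rewrite mul0r ex0 scale1r.
  rewrite intS [1 + _]addrC upowS IHn linearZ /= Ux scalerA -exD rmorphD /=.
  by rewrite mulrDl mul1r.
rewrite intS opprD [- 1 + _]addrC upow_pred IHn uadjZ Ax scalerA -exD rmorphB /=.
by rewrite mulrBl mul1r.
Qed.

Lemma discrete_Delta0_star (l : nat) (a : 'I_l -> R) (f : H) (eps : R) :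
  (forall n : int, (oddpoly a).[n%:~R] \is a Num.int) ->
  discrete_spectrum U -> 0 < eps -> is_Delta0_star l (return_times U (oddpoly a) f eps).
Proof.
move=> hvZ ds eps0; split=> [n []//|F [Fpos hF]].
have e30 : 0 < eps / 3 by rewrite divr_gt0.
have [g [[n [c [e [he gE]]]] fg]] : exists g, lin_span (eigenvectors U) g /\ nm (f - g) < eps / 3.
  have : closure (lin_span (eigenvectors U)) f by rewrite ds.
  case/(_ (ball f (eps / 3)%:C%C)); first by apply: nbhsx_ballx; rewrite ltcR.
  by move=> g [gs]; rewrite -ball_normE /= nm_lt; exists g.
have /choice[t ht] : forall i, exists t, U (e i) = ex t *: e i.
  move=> i; have [e0 [la Ue]] := he i.
  by have [t tE] := cm1_ex (eigenvalue_cm e0 Ue); exists t; rewrite -tE.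
have K0 i : 0 <= cm (c i) * nm (e i) by rewrite mulr_ge0 ?cm_ge0 ?nm_ge0.
(* With the weights [cm (c i) * nm (e i)] the character seminorm at [z] bounds
   [nm (upow U z g - g)]. *)
have [N hN] := odd_poly_recurrence (char_seminorm t K0) a e30.
have [F' [[_ _ [m hm]] FF']] := hF (maxn N (2 ^ l)) (leq_maxr _ _).
have [j [sj hj]] := hN _ m (leq_maxl _ _).
have [k Fk kE] : [set Posz k | k in F']%classic (iter_diff l [seq m i | i <- j]).
  by apply: hm; exists j.
exists k; split; last exact: FF'.
split; first by apply: Fpos; apply: FF'.
rewrite -kE in hj; have vZ := hvZ (Posz k); rewrite -pmulrn in vZ hj.
set z := Num.floor _; have zE : z%:~R = (oddpoly a).[k%:R] by apply/eqP; rewrite -intrEfloor.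
rewrite nm_lt.
have hg : nm (upow U z g - g) < eps / 3.
  apply: le_lt_trans hj; rewrite -zE {1 2}gE upow_sum -sumrB.
  apply: le_trans (nm_sum _ _ _) _; apply: ler_sum => i _.
  rewrite upow_scale (upow_eigen z (ht i)) scalerA -scalerBl nmZ.
  by rewrite -[X in _ - X]mulr1 -mulrBr cmM mulrAC.
have -> : upow U z f - f = upow U z (f - g) + (upow U z g - g) - (f - g).
  by rewrite upow_sub addrA subrK opprB addrA subrK.
apply: le_lt_trans (nmB _ _) _; have := nmD (upow U z (f - g)) (upow U z g - g).
by rewrite nm_upow; lra.
Qed.

End Unitary.

(** * Totally bounded orbits *)

Section TotallyBounded.
Variables (R : realType) (H : completeNormedModType R[i]).
Variables (dot : {dot H for Num.conj}) (hdot : is_inner_product dot).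
Variable U : unitary dot.
Implicit Types (f : H).

Definition tb_orbit f : Prop := forall eps : R, 0 < eps ->
  exists (C : finType) (c : nat -> C), forall m n, c m = c n ->
    nm (iter m U f - iter n U f) <= eps.

(** Without a finite net, a greedy choice would produce an infinite [eps]-separated sequence of
    points. *)
Lemma finite_net (x : nat -> H) (eps : R) (K : nat) :
  (forall ms : nat -> nat, exists i j, [/\ (i < j)%N, (j < K)%N &
     nm (x (ms i) - x (ms j)) < eps]) ->
  exists s : seq nat, forall m, exists2 k, k \in s & nm (x m - x k) < eps.
Proof.
move=> h; apply: contrapT => hs.
have /greedy_sequence[n hn] : forall s : seq nat, exists m,
    forall k, k \in s -> eps <= nm (x m - x k).
  move=> s; apply: contrapT => hm; apply: hs; exists s => m.
  apply: contrapT => hk; apply: hm; exists m => k ks.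
  by rewrite leNgt; apply/negP => lt; apply: hk; exists k.
have [i [j [ij _]]] := h n; rewrite nm_distC; apply/negP; rewrite -leNgt.
by apply: hn; apply: map_f; rewrite mem_iota.
Qed.

Lemma nm_upowN z f : nm (upow U (- z) f - f) = nm (upow U z f - f).
Proof. by rewrite -sub0r -nm_upow_dist // nm_distC. Qed.

(** If [n + i] and [n + j] are both return times, then [g (n + j) - g (n + i)], of degree one less
    in [n], moves [f] by less than [2 * eps]. The overlap lemma supplies such [i < j] for a set of
    [n] of positive density. *)
Lemma posdens_linear f (d : nat) (p : {poly R}) (g : nat -> int) (eps : R) :
  size p = d.+2 -> (forall n, (g n)%:~R = p.[n%:R]) ->
  posdens (fun n => nm (upow U (g n) f - f) < eps) ->
  exists a b : int, a != 0 /\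
    posdens (fun n => nm (upow U (a * Posz n + b) f - f) < 2 ^+ d * eps).
Proof.
elim: d p g eps => [|d IHd] p g eps sp gp hS.
  (* Here [p] is linear, and its integer coefficients are read off from [g 0] and [g 1]. *)
  have pE x : p.[x] = p`_0 + p`_1 * x.
    by rewrite horner_coef sp big_ord_recr big_ord1 /= expr0 expr1 mulr1.
  have p1 : p`_1 != 0.
    by have := lead_coefE p; rewrite sp /= => <-; rewrite lead_coef_eq0 -size_poly_eq0 sp.
  exists (g 1%N - g 0%N), (g 0%N); split.
    apply: contra p1 => /eqP /(congr1 (intr : int -> R)).
    by rewrite rmorphB /= !gp !pE mulr1 mulr0 addr0 addrC addKr => ->.
  rewrite expr0 mul1r; apply: sub_posdens hS => n.
  suff -> : g n = (g 1%N - g 0%N) * Posz n + g 0%N by [].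
  apply: (@intr_inj R); rewrite rmorphD rmorphM rmorphB /= -pmulrn !gp !pE; ring.
have {hS} [K /(_ id)[i [j [ij _ hS]]]] := posdens_overlap hS.
pose p1 := p \Po ('X + i%:R%:P); pose h : R := (j - i)%:R.
have sp1 : size p1 = d.+3 by rewrite size_comp_poly2 ?size_XaddC.
have h0 : h != 0 by rewrite pnatr_eq0 -lt0n subn_gt0.
have [|||a [b [a0 hab]]] := IHd (p1 \Po ('X + h%:P) - p1)
  (fun n => g (n + j)%N - g (n + i)%N) (2 * eps).
- by apply: size_shift_diff.
- move=> n; rewrite rmorphB /= !gp !(hornerE, horner_comp).
  by rewrite /h !natrD natrB 1?ltnW // addrA subrK.
- apply: sub_posdens hS => n /andP[h1 h2]; rewrite -nm_upow_dist //.
  by apply: le_lt_trans (nm_triangle f _ _) _; rewrite (nm_distC f); lra.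
by exists a, b; split=> //; rewrite exprSr -mulrA.
Qed.

(** Among any [K] translates of the return times two share a point [n], so two of the corresponding
    points on the orbit of [U^a] are close. This yields a finite net for that orbit. *)
Lemma tb_orbit_linear f :
  (forall eps : R, 0 < eps -> exists a b : int, a != 0 /\
    posdens (fun n => nm (upow U (a * Posz n + b) f - f) < eps)) -> tb_orbit f.
Proof.
move=> h eps eps0; have e40 : 0 < eps / 4 by rewrite divr_gt0.
have [a [b [a0 hab]]] := h _ e40.
pose x (m : nat) := upow U (a * Posz m) f.
have [K hK] := posdens_overlap hab.
have [s hs] : exists s : seq nat, forall m, exists2 k, k \in s & nm (x m - x k) < eps / 2.
  apply: (@finite_net _ _ K) => ms; have [i [j [ij jK /posdens_inhabited[n]]]] := hK ms.
  move=> /andP[h1 h2]; exists i, j; split=> //; rewrite /x.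
  have -> : nm (upow U (a * Posz (ms i)) f - upow U (a * Posz (ms j)) f) =
      nm (upow U (a * Posz (n + ms i) + b) f - upow U (a * Posz (n + ms j) + b) f).
    by rewrite !nm_upow_dist // !PoszD; congr (nm (upow U _ _ - _)); ring.
  by apply: le_lt_trans (nm_triangle f _ _) _; rewrite (nm_distC f); lra.
have /choice[k hk] : forall m, exists k, k \in s /\ nm (x m - x k) < eps / 2.
  by move=> m; have [k ks hk] := hs m; exists k.
pose A := absz a; have A0 : (0 < A)%N by rewrite absz_gt0.
(* The colour of [m] is its residue modulo [A] together with the net point chosen for its quotient;
   for equal residues only the quotients matter. *)
exists ('I_A.+1 * 'I_(size s).+1)%type,
  (fun m => (inord (m %% A)%N, inord (index (k (m %/ A)%N) s))) => m n [].
have is_ q : (index (k q) s < (size s).+1)%N by rewrite ltnS ltnW // index_mem (hk q).1.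
have mA q : (q %% A < A.+1)%N by apply: leq_trans (ltn_pmod q A0) _.
move=> /(congr1 val) /=; rewrite !inordK // => mn.
move=> /(congr1 val) /=; rewrite !inordK // => /(congr1 (nth 0%N s)).
rewrite !nth_index ?(hk _).1 // => kk.
have -> : nm (iter m U f - iter n U f) = nm (x (m %/ A)%N - x (n %/ A)%N).
  rewrite -!upow_nat !nm_upow_dist //.
  have [az|az] : a = Posz A \/ a = - Posz A by rewrite /A; lia.
    congr (nm (upow U _ _ - _)).
    rewrite {1}(divn_eq m A) {1}(divn_eq n A) mn !PoszD !PoszM az; ring.
  rewrite -nm_upowN; congr (nm (upow U _ _ - _)).
  by rewrite {1}(divn_eq m A) {1}(divn_eq n A) mn !PoszD !PoszM az; ring.
apply: le_trans (nm_triangle (x (k (m %/ A)%N)) _ _) _.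
have [_ h1] := hk (m %/ A)%N; have [_ h2] := hk (n %/ A)%N.
by rewrite {2}kk nm_distC [X in _ + X]nm_distC; rewrite nm_distC; lra.
Qed.

Lemma Delta_star_tb_orbit (l : nat) (a : 'I_l -> R) f :
  oddpoly a != 0 -> (forall n : int, (oddpoly a).[n%:~R] \is a Num.int) ->
  (forall eps : R, 0 < eps -> is_Delta_star l (return_times U (oddpoly a) f eps)) ->
  tb_orbit f.
Proof.
move=> v0 vZ h; apply: tb_orbit_linear => eps eps0.
(* The degree is at least 1, since [v] is nonzero and vanishes at 0. *)
have [d sv] : exists d, size (oddpoly a) = d.+2.
  case E: (size (oddpoly a)) => [|[|d]]; last by exists d.
    by move/eqP: E; rewrite size_poly_eq0 (negPf v0).
  case/negP: v0; have /size_poly1P[c _ vc] : size (oddpoly a) == 1%N by rewrite E.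
  have : (oddpoly a).[0] = 0 by rewrite oddpolyE big1 // => j _; rewrite exprS mul0r mulr0.
  by rewrite vc hornerC => ->; rewrite polyC0.
have e0 : 0 < eps / 2 ^+ d by rewrite divr_gt0 // exprn_gt0.
have vZn n : (Num.floor (oddpoly a).[n%:R])%:~R = (oddpoly a).[n%:R].
  by apply/eqP; rewrite -intrEfloor; apply: (vZ (Posz n)).
have [|aa [b [aa0 hab]]] := posdens_linear sv vZn (eps := eps / 2 ^+ d) (f := f).
  by apply: sub_posdens (Delta_star_posdens (h _ e0)) => n /asboolP[_]; rewrite nm_lt.
exists aa, b; split=> //; rewrite mulrC divfK // in hab.
by rewrite gt_eqF // exprn_gt0.
Qed.

End TotallyBounded.

(** * Limits and orthogonal projections *)

Section Complete.
Variables (R : realType) (H : completeNormedModType R[i]).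

Lemma gt0_complex (e : R[i]) : 0 < e -> exists2 r : R, 0 < r & e = r%:C%C.
Proof.
by move=> e0; exists (complex.Re e); rewrite -?ltcR RRe_real // gtr0_real.
Qed.

(** A general filter covers both ordinary sequences and the ultrafilter used for cluster points. *)
Lemma filter_limit (F : set_system nat) (FF : ProperFilter F) (x : nat -> H) :
  (forall eps : R, 0 < eps ->
     exists2 A, F A & forall m n, A m -> A n -> nm (x m - x n) < eps) ->
  exists z, forall eps : R, 0 < eps -> F [set n | nm (x n - z) < eps]%classic.
Proof.
move=> hx; have cF : cauchy (fmap x F).
  apply: cauchy_exP => e /gt0_complex[r r0 ->]; have [A FA hA] := hx r r0.
  have [m Am] := filter_ex FA; exists (x m); rewrite fmapE.
  by apply: filterS FA => n An; rewrite /= -ball_normE /= nm_lt hA.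
have hz := cauchy_cvg (fmap x F) (FF := fmap_proper_filter x FF) cF; set z := lim (fmap x F) in hz.
exists z => eps eps0; have e0 : 0 < eps%:C%C by rewrite ltcR.
have : F (x @^-1` ball z eps%:C%C)%classic := hz _ (nbhsx_ballx z _ e0).
apply: filterS => n.
by rewrite /= -ball_normE /= nm_lt nm_distC.
Qed.

Lemma cauchy_limit (x : nat -> H) :
  (forall eps : R, 0 < eps -> exists N, forall m n,
     (N <= m)%N -> (N <= n)%N -> nm (x m - x n) < eps) ->
  exists z, forall eps : R, 0 < eps -> exists N, forall n, (N <= n)%N -> nm (x n - z) < eps.
Proof.
move=> hx; have [|z hz] := @filter_limit \oo%classic _ x.
  move=> eps /hx[N hN]; exists [set n | (N <= n)%N]%classic; first by exists N.
  by move=> m n; apply: hN.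
by exists z => eps /hz[N _ hN]; exists N => n /hN.
Qed.

(** An ultrafilter refining the eventuality filter contains one class of each finite colouring, so
    the sequence is Cauchy along it. *)
Lemma cluster_point (x : nat -> H) :
  (forall eps : R, 0 < eps -> exists (C : finType) (c : nat -> C),
     forall m n, c m = c n -> nm (x m - x n) <= eps) ->
  exists z, forall (eps : R) N, 0 < eps -> exists2 n, (N <= n)%N & nm (x n - z) < eps.
Proof.
move=> hx; have [G [GU ooG]] := ultraFilterLemma eventually_filter.
have GF : ProperFilter G := @ultra_proper _ _ GU.
have [|z hz] := filter_limit GF (x := x).
  move=> eps eps0; have [|C [c hc]] := hx (eps / 2); first by rewrite divr_gt0.
  have [c0 Gc0] : exists c0, G [set n | c n = c0]%classic.
    apply: contrapT => h.
    have : G [set n | forall c0, c n <> c0]%classic.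
      apply: filter_forall => c0; have [G0|//] := in_ultra_setVsetC [set n | c n = c0]%classic GU.
      by case: h; exists c0.
    by case/filter_ex => n /(_ (c n)).
  exists [set n | c n = c0]%classic => // m n /= cm0 cn.
  by apply: le_lt_trans (hc m n _) _; rewrite ?cm0 //; lra.
exists z => eps N eps0.
have GN : G [set n | (N <= n)%N]%classic by apply: ooG; exists N.
have [n [Nn hn]] := filter_ex (filterI GN (hz eps eps0)).
by exists n.
Qed.

Lemma closure_nm (A : set H) (f : H) :
  (forall eps : R, 0 < eps -> exists2 y, A y & nm (f - y) < eps) -> closure A f.
Proof.
move=> h B /nbhs_ballP[e /= /gt0_complex[r r0 ->] hB].
have [y Ay hy] := h r r0; exists y; split=> //; apply: hB.
by rewrite -ball_normE /= nm_lt.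
Qed.

Variables (dot : {dot H for Num.conj}) (hdot : is_inner_product dot).

(** [g] is [f] minus its nearest point in the closure of [A], obtained as the limit of a minimising
    sequence. *)
Lemma orthogonal_residual (A : set H) (f : H) : A 0 ->
  (forall c x y, A x -> A y -> A (c *: x + y)) -> ~ closure A f ->
  exists g, g != 0 /\ forall a, A a -> dot g a = 0.
Proof.
move=> A0 AL Af; pose D := [set nm (f - y) | y in A]%classic; pose del := inf D.
have lb : has_lbound D by exists 0 => _ [y _ <-]; apply: nm_ge0.
have hasD : has_inf D by split=> //; exists (nm (f - 0)); exists 0.
have delle y : A y -> del <= nm (f - y) by move=> Ay; apply: ge_inf => //; exists y.
have del0 : 0 < del.
  rewrite ltNge; apply/negP => d0; apply: Af; apply: closure_nm => eps eps0.
  have [_ [y Ay <-] hy] := inf_adherent eps0 hasD.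
  by exists y => //; apply: lt_le_trans hy _; rewrite gerDr.
have /choice[y hy] : forall n : nat, exists y, A y /\ nm (f - y) < del + n.+1%:R^-1.
  move=> n; have n0 : 0 < n.+1%:R^-1 :> R by rewrite invr_gt0.
  by have [_ [y Ay <-] h] := inf_adherent n0 hasD; exists y.
have small (eps : R) : 0 < eps -> exists N, forall n, (N <= n)%N -> n.+1%:R^-1 < eps.
  move=> eps0; exists (Num.truncn eps^-1) => n Nn.
  rewrite invf_plt ?posrE //; have ei : 0 <= eps^-1 by rewrite invr_ge0 ltW.
  have /andP[_ h] := truncn_itv ei; apply: lt_le_trans h _.
  by rewrite ler_nat ltnS.
have [z hz] : exists z, forall eps : R, 0 < eps ->
    exists N, forall n, (N <= n)%N -> nm (y n - z) < eps.
  apply: cauchy_limit => eps eps0.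
  (* The parallelogram law bounds the squared distance by [4 * (del + e) ^+ 2 - 4 * del ^+ 2], at
     most [(8 * del + 4) * e] when [e <= 1]. *)
  have b0 : 0 < 8 * del + 4 by lra.
  have [|N hN] := small (eps ^+ 2 / (8 * del + 4)); first by rewrite divr_gt0 ?exprn_gt0.
  exists N => m n Nm Nn.
  rewrite -(@ltr_pXn2r _ 2) ?nnegrE ?nm_ge0 ?ltW //.
  have eta k : (N <= k)%N -> nm (f - y k) < del + N.+1%:R^-1.
    move=> Nk; apply: lt_le_trans (hy k).2 _; rewrite lerD2l.
    by rewrite lef_pV2 ?posrE // ler_nat ltnS.
  have := hN N (leqnn N); rewrite ltr_pdivlMr // => hNN.
  have e1 : N.+1%:R^-1 <= 1 :> R by rewrite invf_le1 ?ler1n.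
  have e0 : 0 < N.+1%:R^-1 :> R by rewrite invr_gt0.
  set e := N.+1%:R^-1 in e0 e1 hNN eta *.
  have h1 := eta m Nm; have h2 := eta n Nn.
  have := parallelogram hdot (f - y m) (f - y n).
  have -> : f - y m - (f - y n) = - (y m - y n) by rewrite opprB addrC addrA subrK opprB.
  rewrite nmN => par.
  have h3 : 2 * del <= nm (f - y m + (f - y n)).
    have -> : f - y m + (f - y n) = 2 *: (f - (2^-1 *: y m + (2^-1 *: y n + 0))).
      rewrite addr0 scalerBr scalerDr !scalerA divff ?pnatr_eq0 // !scale1r.
      by rewrite scaler_nat mulr2n opprD addrACA.
    rewrite nmZ cm_nat.
    apply: ler_wpM2l => //; apply: delle; apply: (AL); first exact: (hy m).1.
    by apply: AL => //; exact: (hy n).1.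
  have h4 := nm_ge0 (f - y m); have h5 := nm_ge0 (f - y n).
  have de0 : 0 <= del + e by lra.
  have h6 : nm (f - y m) ^+ 2 <= (del + e) ^+ 2 by rewrite ler_pXn2r ?nnegrE // ltW.
  have h7 : nm (f - y n) ^+ 2 <= (del + e) ^+ 2 by rewrite ler_pXn2r ?nnegrE // ltW.
  have h8 : (2 * del) ^+ 2 <= nm (f - y m + (f - y n)) ^+ 2.
    by rewrite ler_pXn2r ?nnegrE ?nm_ge0 // mulr_ge0 // ltW.
  apply: le_lt_trans hNN; move: par h6 h7 h8; rewrite !expr2; nra.
pose g := f - z.
have gle : nm g <= del.
  apply/ler_addgt0Pr => eps eps0; have e20 : 0 < eps / 2 by rewrite divr_gt0.
  have [N1 h1] := hz _ e20; have [N2 h2] := small _ e20.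
  have h3 := h1 (maxn N1 N2) (leq_maxl _ _); have h4 := h2 (maxn N1 N2) (leq_maxr _ _).
  have h5 := lt_trans (hy (maxn N1 N2)).2 (ler_ltD (lexx del) h4).
  apply: le_trans (nm_triangle (y (maxn N1 N2)) _ _) _; lra.
have gge c a : A a -> del <= nm (g - c *: a).
  move=> Aa; apply/ler_addgt0Pr => eps eps0; have [N hN] := hz _ eps0.
  have := delle _ (AL c _ _ Aa (hy N).1).
  have -> : f - (c *: a + y N) = g - c *: a - (y N - z).
    by rewrite /g opprD addrA opprB addrA [f - z - _]addrAC subrK.
  move=> /le_trans; apply; apply: le_trans (nmB _ _) _.
  by rewrite lerD2l; apply/ltW/hN.
exists g; split; first by rewrite -nm_gt0; have := gge 0 0 A0; rewrite scaler0 subr0; lra.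
move=> a Aa; have [->|a0] := eqVneq a 0; first by rewrite linear0r.
have del0' := ltW del0.
(* Subtracting the projection on [a] would shorten [g] below the minimum [del] unless [dot g a] is
   zero. *)
have := gge (dot g a / dot a a) a Aa; rewrite -(@ler_pXn2r _ 2) ?nnegrE ?nm_ge0 //.
rewrite nm_sqr_proj // => h.
have hg : nm g ^+ 2 <= del ^+ 2 by rewrite ler_pXn2r ?nnegrE ?nm_ge0.
have na : 0 < nm a ^+ 2 by rewrite exprn_gt0 // nm_gt0.
have : cm (dot g a) ^+ 2 / nm a ^+ 2 <= 0 by lra.
rewrite ler_pdivrMr // mul0r => h0.
by apply/eqP; rewrite -cm_eq0 -sqrf_eq0 eq_le h0 sqr_ge0.
Qed.

End Complete.

(** * Finite Fourier analysis of an orbit *)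

Section Fourier.
Variables (R : realType).

Lemma prim_root_complex (n : nat) : (0 < n)%N -> exists w : R[i], n.-primitive_root w.
Proof.
pose p : {poly R[i]} := 'X^n - 1; have [r Dp] := closed_field_poly_normal p.
move=> n_gt0; rewrite (monicP _) ?monicXnsubC // scale1r in Dp.
have rn1 : all n.-unity_root r by apply/allP=> z; rewrite -root_prod_XsubC -Dp.
have sz_r : (n < (size r).+1)%N by rewrite -(size_prod_XsubC r id) -Dp size_XnsubC.
have [|z] := hasP (has_prim_root n_gt0 rn1 _ sz_r); last by exists z.
by rewrite -separable_prod_XsubC -Dp separable_Xn_sub_1 // pnatr_eq0 -lt0n.
Qed.

Variables (q' : nat) (w : R[i]).
Let q := q'.+1.
Hypothesis wprim : q.-primitive_root w.

Lemma cm_prim : cm w = 1.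
Proof.
apply/eqP; rewrite -(@pexpr_eq1 _ _ q) ?cm_ge0 // -cmX prim_expr_order //.
by rewrite cm1.
Qed.

Lemma prim_conj k : w ^+ k * (w ^+ k)^* = 1.
Proof. by rewrite -cm_sqr cmX cm_prim !expr1n. Qed.

Lemma prim_orth (s t : 'I_q) :
  \sum_(k < q) w ^+ (k * s) * (w ^+ (k * t))^* = (if s == t then q%:R else 0 : R[i]).
Proof.
pose u := w ^+ s * (w ^+ t)^*.
have -> : \sum_(k < q) w ^+ (k * s) * (w ^+ (k * t))^* = \sum_(k < q) u ^+ k.
  by apply: eq_bigr => k _; rewrite mulnC exprM (mulnC k) exprM rmorphXn -exprMn.
case: eqP => [st|/eqP st].
  rewrite (eq_bigr (fun=> 1)) ?sumr_const ?card_ord // => k _.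
  by rewrite /u st prim_conj expr1n.
have uq : u ^+ q = 1.
  have wq j : (w ^+ j) ^+ q = 1 by rewrite exprAC (prim_expr_order wprim) expr1n.
  by rewrite exprMn -rmorphXn !wq rmorph1 mulr1.
have u1 : u != 1.
  apply: contra st => /eqP u1; have : w ^+ s == w ^+ t.
    by rewrite -[w ^+ s]mulr1 -(prim_conj t) [w ^+ t * _]mulrC mulrA -/u u1 mul1r.
  by rewrite (eq_prim_root_expr wprim) !modn_small.
have := subrX1 u q; rewrite uq subrr => /esym/eqP.
by rewrite mulf_eq0 subr_eq0 (negPf u1) => /eqP.
Qed.

Lemma prim_parseval (gam : 'I_q -> R[i]) :
  \sum_(k < q) cm (\sum_(s < q) w ^+ (k * s) * gam s) ^+ 2 =
  q%:R * \sum_(s < q) cm (gam s) ^+ 2.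
Proof.
apply: complexI; rewrite rmorphM rmorph_nat !rmorph_sum /=.
under eq_bigr do rewrite cm_sqr rmorph_sum mulr_suml.
under eq_bigr => k _ do under eq_bigr => s _ do rewrite mulr_sumr.
rewrite exchange_big mulr_sumr /=; apply: eq_bigr => s _.
rewrite exchange_big /= (bigD1 s) //= [X in _ + X]big1 ?addr0 => [|t ts].
  rewrite cm_sqr.
  transitivity ((\sum_(k < q) w ^+ (k * s) * (w ^+ (k * s))^*) * (gam s * (gam s)^*)).
    by rewrite mulr_suml; apply: eq_bigr => k _; rewrite rmorphM /=; ring.
  by rewrite prim_orth eqxx.
transitivity ((\sum_(k < q) w ^+ (k * s) * (w ^+ (k * t))^*) * (gam s * (gam t)^*)).
  by rewrite mulr_suml; apply: eq_bigr => k _; rewrite rmorphM /=; ring.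
by rewrite prim_orth eq_sym (negPf ts) mul0r.
Qed.

Variables (H : completeNormedModType R[i]).
Variables (dot : {dot H for Num.conj}) (hdot : is_inner_product dot).
Variable a : 'I_q -> H.

Definition fourier (k : 'I_q) : H := \sum_(n < q) w ^+ (k * n) *: a n.

(** The sum [m + s] is taken in ['I_q], so this is the cyclic autocorrelation. *)
Definition autocorr (s : 'I_q) : R[i] := \sum_(m < q) dot (a (m + s)) (a m).

Lemma fourier_autocorr (k : 'I_q) :
  (nm (fourier k) ^+ 2)%:C%C = \sum_(s < q) w ^+ (k * s) * autocorr s.
Proof.
rewrite -(dotxx hdot) /fourier linear_sumr /=.
under [RHS]eq_bigr do rewrite mulr_sumr.
rewrite [RHS]exchange_big /=; apply: eq_bigr => m _.
rewrite dotZr linear_sumlz mulr_sumr /=.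
rewrite (reindex_inj (addrI m)) /=; apply: eq_bigr => s _.
rewrite dotZl mulrA; congr (_ * _).
have -> : w ^+ (k * (m + s)%R) = w ^+ (k * m) * w ^+ (k * s).
  rewrite -exprD -mulnDr mulnC exprM mulnC; rewrite exprM.
  by rewrite /= (prim_expr_mod wprim) -!exprM.
by rewrite mulrA [_^* * _]mulrC prim_conj mul1r.
Qed.

(** The sum of the fourth powers of the Fourier coefficients is at most their largest square times
    the sum of their squares; Parseval evaluates both sums. *)
Lemma fourier_peak : exists k, \sum_(s < q) cm (autocorr s) ^+ 2 <=
  nm (fourier k) ^+ 2 * \sum_(m < q) nm (a m) ^+ 2.
Proof.
have S4 : \sum_(k < q) (nm (fourier k) ^+ 2) ^+ 2 = q%:R * \sum_(s < q) cm (autocorr s) ^+ 2.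
  rewrite -prim_parseval; apply: eq_bigr => k _.
  by rewrite -fourier_autocorr cm_real ger0_norm ?sqr_ge0.
have S2 : \sum_(k < q) nm (fourier k) ^+ 2 = q%:R * \sum_(m < q) nm (a m) ^+ 2.
  apply: complexI; rewrite (rmorphM (real_complex R) q%:R) rmorph_nat !rmorph_sum /=.
  under eq_bigr do rewrite fourier_autocorr.
  rewrite exchange_big (bigD1 ord0) //= [X in _ + X]big1 ?addr0 => [|s s0].
    have -> : autocorr ord0 = \sum_(m < q) (nm (a m) ^+ 2)%:C%C.
      by apply: eq_bigr => m _; rewrite -(dotxx hdot) addr0.
    rewrite -mulr_suml; congr (_ * _).
    by under eq_bigr do rewrite muln0 expr0; rewrite sumr_const card_ord.
  rewrite -mulr_suml; have := prim_orth s ord0; rewrite (negPf s0).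
  under eq_bigr do rewrite muln0 expr0 rmorph1 mulr1.
  by move=> ->; rewrite mul0r.
case: (@arg_maxP _ _ 'I_q ord0 predT (fun k => nm (fourier k) ^+ 2) isT) => k _ hk.
exists k; rewrite -(@ler_pM2l _ q%:R) ?ltr0n // -S4 mulrCA -S2 mulr_sumr.
by apply: ler_sum => i _; rewrite expr2; apply: ler_wpM2r; [exact: sqr_ge0|exact: hk].
Qed.

End Fourier.

(** * Eigenvectors in the hull of a totally bounded orbit *)

Section Eigen.
Variables (R : realType) (H : completeNormedModType R[i]).
Variables (dot : {dot H for Num.conj}) (hdot : is_inner_product dot).
Variable U : unitary dot.
Variables (g : H) (g0 : g != 0) (tbg : tb_orbit U g).

Let A := nm g.
Let A0 : 0 < A. Proof. by rewrite nm_gt0. Qed.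

Lemma nm_iter_dist m n : (n <= m)%N ->
  nm (iter m U g - iter n U g) = nm (iter (m - n) U g - g).
Proof. by move=> nm; rewrite -!upow_nat nm_upow_dist // subzn. Qed.

(** Pigeonhole on the multiples of [Q.+1], whose differences exceed [Q]. *)
Lemma near_period (del : R) (Q : nat) : 0 < del ->
  exists2 q, (Q < q)%N & nm (iter q U g - g) <= del.
Proof.
move=> /tbg[C [c hc]].
pose h (i : 'I_#|C|.+1) := c (i * Q.+1)%N.
have /injectivePn[i [j ij hij]] : ~~ injectiveb h.
  apply/negP => /injectiveP/leq_card; rewrite card_ord; lia.
wlog lt_ij : i j ij hij / (i < j)%N.
  move=> W; have [lt|ji|/val_inj e] := ltngtP i j; first exact: (W i j).
  - by apply: (W j i) => //; rewrite eq_sym.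
  - by rewrite e eqxx in ij.
exists ((j - i) * Q.+1)%N; first by rewrite -subn_gt0 in lt_ij; nia.
rewrite mulnBl -nm_iter_dist; first by apply: hc; rewrite -/(h j) -hij.
by rewrite leq_mul2r ltnW ?orbT.
Qed.

(** Some colour class holds at least [q / #|C|] of the times below [q]; subtracting its least
    element turns all of them into return times. *)
Lemma return_count : exists M : nat, forall q : nat,
  (q <= M * #|[set s : 'I_q | (nm (iter s U g - g) <= A / 2)%R]|)%N.
Proof.
have [|C [c hc]] := tbg (_ : 0 < A / 2); first by rewrite divr_gt0.
exists #|C| => q; have [->//|q0] := posnP q.
pose D (x : C) := [set n : 'I_q | c n == x].
have [x hx] : exists x, (q <= #|C| * #|D x|)%N.
  apply: contrapT => h.
  have qE : q = (\sum_x #|D x|)%N.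
    rewrite -[LHS]card_ord -sum1_card (partition_big (fun n : 'I_q => c n) xpredT) //=.
    by apply: eq_bigr => x _; rewrite -sum1_card; apply: eq_bigl => n; rewrite inE.
  have lt x : (#|C| * #|D x| < q)%N by rewrite ltnNge; apply/negP => h'; apply: h; exists x.
  have : (\sum_x #|C| * #|D x| <= \sum_(x : C) q.-1)%N.
    by apply: leq_sum => x _; have := lt x; lia.
  rewrite -big_distrr /= -qE sum_nat_const leq_mul2l => /orP[/eqP C0|]; last by lia.
  by have := card0_eq C0 (c 0%N).
apply: leq_trans hx _; rewrite leq_mul2l; apply/orP; right.
have [->|[n0 n0D]] := set_0Vmem (D x); first by rewrite cards0.
case: (arg_minnP (fun n : 'I_q => val n) n0D) => m mD hm.
pose f (n : 'I_q) : 'I_q := Ordinal (leq_ltn_trans (leq_subr m n) (ltn_ord n)).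
rewrite -(@card_in_imset _ _ f (D x)); last first.
  move=> n1 n2 /hm h1 /hm h2 /(congr1 val) /= e; apply: val_inj.
  by move: h1 h2 e => /=; lia.
apply: subset_leq_card; apply/fintype.subsetP => _ /imsetP[n nD ->]; rewrite inE /=.
rewrite -nm_iter_dist; last exact: hm.
have cD k : k \in D x -> c k = x by rewrite inE => /eqP.
by apply: hc; rewrite (cD n nD) (cD m mD).
Qed.

Definition avg (v : R[i]) (q : nat) : H :=
  q%:R^-1 *: \sum_(n < q) v ^+ n *: iter n U g.

Lemma avg_peak : exists2 kap : R, 0 < kap & forall Q : nat, exists v q,
  [/\ (Q < q)%N, cm v = 1 & kap <= nm (avg v q) ^+ 2].
Proof.
(* The constant results from [|G| * (q * A^2 / 4)^2 <= X * q * A^2] and [q <= (M + 1) * |G|], where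
   [X / q^2] is the squared norm of the average. *)
have [M hM] := return_count; exists (A ^+ 2 / (16 * M.+1%:R)).
  by rewrite divr_gt0 ?exprn_gt0 // mulr_gt0.
move=> Q; have [|[//|q'] Qq hq] := near_period Q (_ : 0 < A / 4); first by rewrite divr_gt0.
set q := q'.+1 in Qq hq *.
have [w wprim] := prim_root_complex R (ltn0Sn q').
pose a (n : 'I_q) := iter n U g.
have [k hk] := fourier_peak wprim hdot a.
exists (w ^+ k), q; split=> //; first by rewrite cmX (cm_prim wprim) expr1n.
have avgE : avg (w ^+ k) q = q%:R^-1 *: fourier w a k.
  by congr (_ *: _); apply: eq_bigr => n _; rewrite exprM.
have nma n : nm (a n) = A by rewrite /a -upow_nat nm_upow.
(* A return within [A / 2] and a near period within [A / 4] move each point by at most [3 * A / 4],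
   so each correlation has real part at least [A ^+ 2 / 4]. *)
have good (s : 'I_q) : nm (iter s U g - g) <= A / 2 -> q%:R * (A ^+ 2 / 4) <= cm (autocorr dot a s).
  move=> hs; apply: le_trans (Re_le_cm _); rewrite /autocorr raddf_sum /=.
  rewrite -[q in q%:R]card_ord mulr_natl -sumr_const; apply: ler_sum => m _.
  have d1 : nm (a (m + s) - a m) <= 3 * A / 4.
    apply: le_trans (nm_triangle (iter (m + s)%N U g) _ _) _.
    have h1 : nm (a (m + s) - iter (m + s)%N U g) <= A / 4.
      rewrite /a /=; have [ms|ms] := ltnP (m + s) q.
        by rewrite modn_small // subrr nm0 divr_ge0 // ltW.
      (* When the cyclic index wraps around, the near period [q] makes up for the shift. *)
      have -> : ((m + s) %% q = m + s - q)%N.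
        by rewrite -{1}(subnK ms) modnDr modn_small //; have := ltn_ord m; have := ltn_ord s; lia.
      by rewrite nm_distC nm_iter_dist ?leq_subr // subKn.
    have h2 : nm (iter (m + s)%N U g - a m) <= A / 2.
      by rewrite /a nm_iter_dist ?leq_addr // addKn.
    by lra.
  have -> : dot (a (m + s)) (a m) = dot (a m) (a m) - dot (a m - a (m + s)) (a m).
    by rewrite linearBl /= opprB [RHS]addrC subrK.
  rewrite raddfB /= (dotxx hdot) nma /=.
  have := Re_le_cm (dot (a m - a (m + s)) (a m)).
  have := cauchy_schwarz hdot (a m - a (m + s)) (a m); rewrite nma nm_distC.
  have := ler_wpM2r (ltW A0) d1; rewrite expr2; lra.
have qpos : 0 < q%:R :> R by rewrite ltr0n.
set G := [set s : 'I_q | nm (iter s U g - g) <= A / 2] in hM *.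
have lowS : #|G|%:R * (q%:R * (A ^+ 2 / 4)) ^+ 2 <= \sum_(s < q) cm (autocorr dot a s) ^+ 2.
  rewrite mulr_natl -sumr_const big_mkcond /=; apply: ler_sum => s _.
  case: ifP => [|_]; last exact: sqr_ge0.
  rewrite inE => /good h; rewrite ler_pXn2r ?nnegrE ?cm_ge0 //.
  by rewrite mulr_ge0 ?divr_ge0 ?sqr_ge0 // ltW.
have {hk}lowF := le_trans lowS hk.
have sumA : \sum_(m < q) nm (a m) ^+ 2 = q%:R * A ^+ 2.
  by under eq_bigr do rewrite nma; rewrite sumr_const card_ord mulr_natl.
rewrite sumA in lowF.
have Gq : q%:R <= M.+1%:R * #|G|%:R :> R.
  by rewrite -natrM ler_nat; apply: leq_trans (hM q) _; apply: leq_mul; rewrite ?leqnSn.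
rewrite avgE nmZ exprMn cmV cm_nat.
have A2 : 0 < A ^+ 2 by rewrite exprn_gt0.
rewrite ler_pdivrMr ?mulr_gt0 // mulrC exprVn.
rewrite -(@ler_pM2l _ (q%:R ^+ 3 * A ^+ 2)); last by rewrite mulr_gt0 ?exprn_gt0.
set X := nm (fourier w a k) ^+ 2 in lowF *.
have -> : q%:R ^+ 3 * A ^+ 2 * (16 * M.+1%:R * (q%:R ^- 2 * X)) =
   M.+1%:R * 16 * (X * (q%:R * A ^+ 2)) by field; rewrite gt_eqF.
apply: le_trans (_ : M.+1%:R * 16 * (#|G|%:R * (q%:R * (A ^+ 2 / 4)) ^+ 2) <= _); last first.
  by rewrite ler_pM2l // mulr_gt0.
have -> : M.+1%:R * 16 * (#|G|%:R * (q%:R * (A ^+ 2 / 4)) ^+ 2) =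
   (M.+1%:R * #|G|%:R) * (q%:R ^+ 2 * A ^+ 2 * A ^+ 2) by field.
have -> : q%:R ^+ 3 * A ^+ 2 * A ^+ 2 = q%:R * (q%:R ^+ 2 * A ^+ 2 * A ^+ 2) by ring.
by rewrite ler_pM2r // !mulr_gt0 ?exprn_gt0.
Qed.

(** Applying [v U] shifts the sum by one term, so all but the two end terms cancel. *)
Lemma avg_approx_eigen v q : (0 < q)%N -> cm v = 1 ->
  nm (U (avg v q) - v^-1 *: avg v q) <= 2 * A / q%:R.
Proof.
move=> q0 v1; have v0 : v != 0 by rewrite -cm_eq0 v1 oner_eq0.
have qpos : 0 < q%:R :> R by rewrite ltr0n.
set F := \sum_(n < q) v ^+ n *: iter n U g.
have -> : U (avg v q) - v^-1 *: avg v q = (q%:R^-1 * v^-1) *: (v *: U F - F).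
  by rewrite /avg -/F linearZ /= scalerA scalerBr scalerA divfK // [v^-1 * _]mulrC.
have -> : v *: U F - F = v ^+ q *: iter q U g - g.
  rewrite /F linear_sum scaler_sumr /=.
  have -> : \sum_(i < q) v *: U (v ^+ i *: iter i U g) =
      \sum_(i < q) v ^+ i.+1 *: iter i.+1 U g.
    by apply: eq_bigr => i _; rewrite linearZ /= scalerA -exprS.
  have := big_ord_recr q (fun i => v ^+ i *: iter i U g) (op := +%R) (idx := 0).
  rewrite big_ord_recl /= expr0 scale1r => h.
  have -> : \sum_(i < q) v ^+ i.+1 *: iter i.+1 U g =
      \sum_(i < q) v ^+ i *: iter i U g + v ^+ q *: iter q U g - g.
    by rewrite -h [RHS]addrC addKr.
  by rewrite [\sum_(i < q) _ + _]addrC addrAC addrK.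
rewrite nmZ cmM !cmV v1 invr1 mulr1 cm_nat.
rewrite mulrC ler_pM2r ?invr_gt0 //; apply: le_trans (nmB _ _) _.
by rewrite nmZ cmX v1 expr1n mul1r -upow_nat nm_upow // -/A; lra.
Qed.

(** Replacing every orbit point by a representative of its colour turns all averages, of whatever
    length, into combinations of the same finitely many vectors with coefficients in the unit disc,
    which a grid covers. *)
Lemma avg_tb (eps : R) : 0 < eps -> exists (C : finType) (c : R[i] -> nat -> C),
  forall v q v' q', (0 < q)%N -> (0 < q')%N -> cm v = 1 -> cm v' = 1 ->
  c v q = c v' q' -> nm (avg v q - avg v' q') <= eps.
Proof.
move=> eps0; have e30 : 0 < eps / 3 by rewrite divr_gt0.
have [C [c hc]] := tbg e30.
have [rep hrep] : exists rep : C -> nat, forall n, c (rep (c n)) = c n.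
  have /choice[rep hrep] : forall x : C, exists m, (exists n, c n = x) -> c m = x.
    move=> x; have [[n <-]|nx] := pselect (exists n, c n = x); first by exists n.
    by exists 0%N.
  by exists rep => n; apply: hrep; exists n.
pose d v q (x : C) := q%:R^-1 * \sum_(n < q | c n == x) v ^+ n : R[i].
pose u x := iter (rep x) U g.
have dle v q x : (0 < q)%N -> cm v = 1 -> cm (d v q x) <= 1.
  move=> q0 v1; rewrite cmM cmV cm_nat mulrC ler_pdivrMr ?ltr0n // mul1r.
  apply: le_trans (cm_sum _ _ _) _.
  under eq_bigr do rewrite cmX v1 expr1n.
  by rewrite sumr_const ler_nat -[leqRHS]card_ord max_card.
have appr v q : (0 < q)%N -> cm v = 1 -> nm (avg v q - \sum_x d v q x *: u x) <= eps / 3.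
  move=> q0 v1.
  have -> : \sum_x d v q x *: u x = q%:R^-1 *: \sum_(n < q) v ^+ n *: u (c n).
    rewrite scaler_sumr (partition_big (fun n : 'I_q => c n) xpredT) //=.
    apply: eq_bigr => x _; rewrite /d -scalerA scaler_suml scaler_sumr.
    by apply: eq_bigr => n /eqP ->.
  rewrite -scalerBr -sumrB nmZ cmV cm_nat mulrC ler_pdivrMr ?ltr0n //.
  apply: le_trans (nm_sum _ _ _) _.
  rewrite mulrC -[q in q%:R]card_ord mulr_natl -sumr_const; apply: ler_sum => n _.
  by rewrite -scalerBr nmZ cmX v1 expr1n mul1r; apply: hc; rewrite hrep.
pose B : R := #|C|%:R * A.
have B0 : 0 <= B by rewrite mulr_ge0 // ltW.
have eta0 : 0 < eps / 3 / (B + 1) by rewrite divr_gt0 // ltr_wpDl.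
have [D [e he]] := grid_complex ler01 eta0.
exists {ffun C -> D}, (fun v q => [ffun x => e (d v q x)]) => v q v' q' q0 q'0 v1 v'1 /ffunP h.
apply: le_trans (nm_triangle (\sum_x d v q x *: u x) _ _) _.
have h1 := appr v q q0 v1; have h2 := appr v' q' q'0 v'1.
suff h3 : nm (\sum_x d v q x *: u x - \sum_x d v' q' x *: u x) <= eps / 3.
  have := nm_triangle (\sum_x d v' q' x *: u x) (\sum_x d v q x *: u x) (avg v' q').
  by rewrite [X in _ <= _ + X]nm_distC; lra.
rewrite -sumrB; apply: le_trans (nm_sum _ _ _) _.
apply: le_trans (_ : \sum_(x : C) (eps / 3 / (B + 1) * A) <= _).
  apply: ler_sum => x _; rewrite -scalerBl nmZ /u -upow_nat nm_upow // -/A.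
  apply: ler_wpM2r; first exact: ltW.
  by apply: he; [exact: dle|exact: dle|have := h x; rewrite !ffunE].
rewrite sumr_const -[_ *+ #|_|]mulr_natl mulrCA -/B mulrAC ler_pdivrMr ?ltr_wpDl //.
by apply: ler_wpM2l; [exact: ltW|rewrite lerDl].
Qed.

(** Approximate eigenvalues force equality in Cauchy-Schwarz for [U z] and [z], so [U z] is its own
    projection on the line of [z]; no limit of the [mu] is taken. *)
Lemma approx_eigen (z : H) : z != 0 ->
  (forall eps : R, 0 < eps -> exists2 mu, cm mu = 1 & nm (U z - mu *: z) <= eps) ->
  eigenvectors U z.
Proof.
move=> z0 h; split=> //; exists (dot (U z) z / dot z z).
have nz : 0 < nm z by rewrite nm_gt0.
apply/eqP; rewrite -subr_eq0 -nm_eq0 -sqrf_eq0 eq_le sqr_ge0 andbT.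
rewrite nm_sqr_proj // nmU // subr_le0 ler_pdivlMr ?exprn_gt0 // -exprMn -expr2.
rewrite ler_pXn2r ?nnegrE ?cm_ge0 ?exprn_ge0 ?nm_ge0 //.
apply/ler_addgt0Pr => eps eps0.
have [mu mu1 hmu] := h (eps / nm z) (divr_gt0 eps0 nz).
have e1 : dot (mu *: z) z = dot (U z) z - dot (U z - mu *: z) z.
  by rewrite linearBl /= opprB [RHS]addrC subrK.
have : cm (dot (mu *: z) z) = nm z ^+ 2.
  by rewrite dotZl (dotxx hdot) cmM mu1 mul1r cm_real ger0_norm ?sqr_ge0.
rewrite e1 => <-; apply: le_trans (cmD _ _) _; rewrite cmN lerD2l.
apply: le_trans (cauchy_schwarz hdot _ _) _.
by rewrite -ler_pdivlMr.
Qed.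

Lemma tb_orbit_eigen : exists2 e, eigenvectors U e & dot g e <> 0.
Proof.
apply: contrapT => hperp.
have perp e : eigenvectors U e -> dot g e = 0.
  by move=> he; apply: contrapT => h; apply: hperp; exists e.
have [kap kap0 hk] := avg_peak.
have /choice[v /choice[q hvq]] := hk.
have q0 j : (0 < q j)%N by have [] := hvq j; lia.
have v1 j : cm (v j) = 1 by have [] := hvq j.
have [|z hz] := cluster_point (x := fun j => avg (v j) (q j)).
  move=> eps /avg_tb[C [c hc]]; exists C, (fun j => c (v j) (q j)) => m n.
  by apply: hc.
(* All the averages have norm at least [Num.sqrt kap], so they stay away from 0. *)
have z0 : z != 0.
  apply/eqP => z0; pose r := Num.sqrt kap; have r0 : 0 < r by rewrite sqrtr_gt0.
  have [j _] := hz r 0%N r0; rewrite z0 subr0; apply/negP; rewrite -leNgt.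
  rewrite -(@ler_pXn2r _ 2) ?nnegrE ?nm_ge0 ?(ltW r0) // sqr_sqrtr ?(ltW kap0) //.
  by have [] := hvq j.
have nz : 0 < nm z by rewrite nm_gt0.
have eig : eigenvectors U z.
  apply: approx_eigen => // eps eps0.
  have e30 : 0 < eps / 3 by rewrite divr_gt0.
  have ei : 0 <= 2 * A / (eps / 3).
    by apply: divr_ge0; [apply: mulr_ge0 => //; exact: ltW|exact: ltW].
  (* Since [j < q j], this lower bound on [j] brings the eigenvector error [2 * A / q j] down to
     [eps / 3]. *)
  have [j Nj hj] := hz _ (Num.truncn (2 * A / (eps / 3))) e30.
  have v0 : cm (v j)^-1 = 1 by rewrite cmV v1 invr1.
  exists (v j)^-1 => //; set x := avg (v j) (q j) in hj.
  have h1 : nm (U x - (v j)^-1 *: x) <= eps / 3.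
    apply: le_trans (avg_approx_eigen (q0 j) (v1 j)) _.
    rewrite ler_pdivrMr ?ltr0n // [leRHS]mulrC -ler_pdivrMr //.
    have /andP[_ h] := truncn_itv ei; apply: le_trans (ltW h) _.
    by rewrite ler_nat; have [] := hvq j; lia.
  have -> : U z - (v j)^-1 *: z = U (z - x) + (U x - (v j)^-1 *: x) - (v j)^-1 *: (z - x).
    by rewrite linearB scalerBr /= opprB !addrA !subrK.
  apply: le_trans (nmB _ _) _; rewrite nmZ v0 mul1r.
  have := nmD (U (z - x)) (U x - (v j)^-1 *: x); rewrite nmU // nm_distC; lra.
have [_ [la Uz]] := eig.
have la0 : la != 0 by rewrite -cm_eq0 (eigenvalue_cm hdot z0 Uz) oner_eq0.
(* Orthogonality to the eigenvector [z] passes along the orbit of [g], hence to all averages; but an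
   average within distance [nm z] of [z] cannot be orthogonal to it. *)
have orb n : dot (iter n U g) z = 0.
  elim: n => [|n IHn] /=; first exact: perp.
  apply/eqP; have := dotU U (iter n U g) z; rewrite IHn Uz dotZr => /eqP.
  by rewrite mulf_eq0 conjC_eq0 (negPf la0).
have avg0 w m : dot (avg w m) z = 0.
  rewrite /avg dotZl linear_sumlz; apply/eqP; rewrite mulf_eq0; apply/orP; right.
  by apply/eqP; apply: big1 => n _; rewrite [LHS]dotZl orb mulr0.
have [j _ hj] := hz _ 0%N nz.
have := cauchy_schwarz hdot (avg (v j) (q j) - z) z.
rewrite linearBl /= avg0 sub0r cmN (dotxx hdot) cm_real ger0_norm ?sqr_ge0 //.
by rewrite expr2 ler_pM2r // leNgt hj.
Qed.

End Eigen.

(** * Linear spans, and discrete spectrum from totally bounded orbits *)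

Section Span.
Variables (R : realType) (H : completeNormedModType R[i]).
Implicit Types E : set H.

Lemma lin_span0 E : lin_span E 0.
Proof. by exists 0%N, (fun=> 0), (fun=> 0); split=> [[]//|]; rewrite big_ord0. Qed.

Lemma sub_lin_span E : (E `<=` lin_span E)%classic.
Proof. by move=> x Ex; exists 1%N, (fun=> 1), (fun=> x); split=> //; rewrite big_ord1 scale1r. Qed.

Lemma lin_span_lin E c x y : lin_span E x -> lin_span E y -> lin_span E (c *: x + y).
Proof.
move=> [n [a [e [he ->]]]] [m [b [f [hf ->]]]].
exists (n + m)%N, (fun i => match fintype.split i with inl i => c * a i | inr i => b i end),
  (fun i => match fintype.split i with inl i => e i | inr i => f i end); split.
  by move=> i; case: (fintype.split i).
rewrite big_split_ord /= scaler_sumr; congr (_ + _); apply: eq_bigr => i _.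
  by rewrite (unsplitK (inl i)) scalerA.
by rewrite (unsplitK (inr i)).
Qed.

End Span.

Lemma tb_orbit_discrete (R : realType) (H : completeNormedModType R[i])
    (dot : {dot H for Num.conj}) (hdot : is_inner_product dot) (U : unitary dot) :
  (forall f, tb_orbit U f) -> discrete_spectrum U.
Proof.
move=> tb; apply/seteqP; split=> // f _; apply: contrapT => hf.
have [g [g0 hg]] := orthogonal_residual hdot (@lin_span0 _ _ _) (@lin_span_lin _ _ _) hf.
have [e he] := tb_orbit_eigen hdot g0 (tb g).
by apply; apply: hg; apply: sub_lin_span.
Qed.


Theorem theorem6p2 (R : realType) (H : completeNormedModType R[i])
    (dot : {dot H for Num.conj}) (hdot : is_inner_product dot)
    (U : unitary dot) (l : nat) (a : 'I_l -> R)
    (hv0 : oddpoly a != 0)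
    (hvZ : forall n : int, (oddpoly a).[n%:~R] \is a Num.int) :
  (discrete_spectrum U <->
     (forall (f : H) (eps : R), 0 < eps ->
        is_Delta0_star l (return_times U (oddpoly a) f eps))) /\
  (discrete_spectrum U <->
     (forall (f : H) (eps : R), 0 < eps ->
        is_Delta_star l (return_times U (oddpoly a) f eps))).
Proof.
have i_ii : discrete_spectrum U -> forall (f : H) (eps : R), 0 < eps ->
    is_Delta0_star l (return_times U (oddpoly a) f eps).
  by move=> ds f eps; apply: discrete_Delta0_star.
have iii_i : (forall (f : H) (eps : R), 0 < eps ->
    is_Delta_star l (return_times U (oddpoly a) f eps)) -> discrete_spectrum U.
  move=> h; apply: (tb_orbit_discrete hdot) => f.
  by apply: Delta_star_tb_orbit (h f).
split; split=> //.
- by move=> h; apply: iii_i => f eps eps0; apply: Delta0_star_Delta_star; apply: h.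
- by move=> ds f eps eps0; apply: Delta0_star_Delta_star; apply: i_ii.
Qed.
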